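(* Let $p\in[3/4,1)$ and let $(X_n)_{n\ge0}$ be the ''have your cookie and eat it'' (HYC) random walk with parameter $p$ started at $X_0=0$. Then its speed satisfies $v(p)=4p-3$, i.e. $$\lim_{n\to\infty}\frac{X_n}{n}=4p-3\quad\text{almost surely.}$$
   Context: The HYC random walk with parameter $p\in(1/2,1)$ is the following nearest-neighbour self-interacting walk $(X_n)_{n\ge0}$ on $\mathbb Z$. Initially there is one cookie at every site of $\mathbb Z$. Whenever the walk is at a site that still has its cookie, it steps right with probability $p$ and left with probability $1-p$ (given the past); if it steps left from that site, the cookie there is removed (eaten), and if it steps right the cookie remains. Whenever the walk is at a site whose cookie has been eaten, it steps left or right with probability $1/2$ each. It is known (Pinsky) that there is a deterministic constant $v(p)$, called the speed, with $v(p)=\lim_{n\to\infty}X_n/n$ almost surely. *)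

(* Defs.v *)
From HB Require Import structures.
From mathcomp Require Import all_boot all_order all_algebra.
From mathcomp Require Import all_classical all_reals all_analysis.
Set Implicit Arguments.
Unset Strict Implicit.
Unset Printing Implicit Defensive.
Import Order.TTheory GRing.Theory Num.Theory.
Import numFieldNormedType.Exports.

Local Open Scope classical_set_scope.
Local Open Scope ring_scope.

(* Along the trajectory x, the cookie at site k has been eaten before time n
   when the walk has already made a left step from k; only x 0, ..., x n
   matter. *)
Definition cookie_eaten (x : nat -> int) (n : nat) (k : int) : bool :=
  [exists i : 'I_n, (x i == k) && (x i.+1 == k - 1)].

Definition right_prob (R : realType) (p : R) (x : nat -> int) (n : nat) : R :=
  if cookie_eaten x n (x n) then 2^-1 else p.

Definition history (T : Type) (X : nat -> T -> int) (x : nat -> int)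
    (n : nat) : set T :=
  [set t | forall i : nat, (i <= n)%N -> X i t = x i].

(* The past (X_0, ..., X_n) is discrete, so its sigma-algebra is generated by
   the events [history X x n].  The conditional law of the next step given the
   past is expressed on these events by P(A `&` B) = q * P(A), which also covers
   those of probability zero.  The two step probabilities add up to one, hence
   the walk is almost surely nearest-neighbour. *)
Record is_HYC_walk (R : realType) (d : measure_display) (T : measurableType d)
    (P : probability T R) (p : R) (X : nat -> T -> int) : Prop := {
  HYC_measurable : forall (n : nat) (k : int), measurable [set t | X n t = k] ;
  HYC_start : {ae P, forall t, X 0%N t = 0} ;
  HYC_right : forall (n : nat) (x : nat -> int),
    P (history X x n `&` [set t | X n.+1 t = x n + 1]) =
      ((right_prob p x n)%:E * P (history X x n))%E ;
  HYC_left : forall (n : nat) (x : nat -> int),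
    P (history X x n `&` [set t | X n.+1 t = x n - 1]) =
      ((1 - right_prob p x n)%:E * P (history X x n))%E
}.

Definition has_speed (R : realType) (d : measure_display)
    (T : measurableType d) (P : probability T R) (X : nat -> T -> int)
    (v : R) : Prop :=
  {ae P, forall t, (X n t)%:~R / n%:R @[n --> \oo] --> v}.

(* Main.v *)
Require Import Defs.
From HB Require Import structures.
From mathcomp Require Import all_boot all_order all_algebra.
From mathcomp Require Import all_classical all_reals all_analysis.
From mathcomp Require Import ring lra zify.
Import Order.TTheory GRing.Theory Num.Theory.
Import numFieldNormedType.Exports.
Local Open Scope classical_set_scope.
Local Open Scope ring_scope.
Set Implicit Arguments.
Unset Strict Implicit.
Unset Printing Implicit Defensive.

(** Attach to every site a stack of coins, read one at a time whenever the walk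
    steps from that site: right with probability [p] until the first
    left has appeared, fair afterwards.  When the walk stands at [N] or beyond, every
    site [k] of [0, N) has been left to the right exactly once more than
    [k + 1] has been left to the left.  Hence the coins it has used can also be
    found by reading the stacks site by site, from [N - 1] downwards, each
    until it shows one more right than the previous site showed lefts.
    Such a reading is called here the exploration; it is a Markov chain whose
    state records the number [s] of finished sites, the number [j + 1] of rights
    still wanted and the number [v] of lefts seen at the current site.  Whether
    [N] sites get finished with [n] coins is a property of the stacks alone
    ([certificate]), so it has the same probability in both orders
    ([strategy_comparison]); therefore the position of the walk at time [n] and
    the number of sites finished with [n] coins have the same linear growth
    ([walk_right_of], [walk_confined]).

    The exploration is solvable: there is an explicit [corrector], quadratic in
    the width [j + v + 1] of the state, such that [s - corrector - (4 p - 3) n]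
    is a martingale ([corrector_martingale]); this is where the value
    [4 p - 3] comes from.  It remains to see that the width stays well below
    [sqrt n].  For [p > 3/4] a function of the state of order
    [width ^ (2 + beta)] with some [beta > 0] has bounded drift
    ([potential_drift]), which makes widths of order [n ^ (1/2 - eta)] unlikely.
    Chebyshev then gives a failure probability [C / L ^ 2] along the times
    [n = L ^ M] ([explore_concentration]).

    The walk cannot be far below its maximum, or far to the left of the origin,
    because [X_n - c * #eaten] with [c = (2 p - 1) / (1 - p)] is a
    martingale with bounded increments, whereas backtracking by [k]
    eats [k] cookies ([walk_left_of], [walk_left_of_origin]).  At [p = 3/4] the
    lower bound is this last remark alone, and the upper bound follows from
    [p' > 3/4] close to [3/4], because the exploration progresses faster with
    stronger cookies ([reach_prob_mono]).

    Finally Borel-Cantelli along [L ^ M] and the nearest-neighbour property,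
    which controls the walk between consecutive such times, give the almost
    sure limit. *)

(** * Expectations along a binary chain, and the exploration chain *)

(** Expectations at a finite horizon are obtained by backward recursion, so that the
    chains below need no probability space. *)
Fixpoint expect (R : realFieldType) (S : Type) (pr : S -> R)
    (nxt : S -> bool -> S) (n : nat) (s : S) (H : S -> R) : R :=
  if n is m.+1 then
    pr s * expect pr nxt m (nxt s true) H + (1 - pr s) * expect pr nxt m (nxt s false) H
  else H s.

Lemma expect_mono (R : realFieldType) (S : Type) (pr : S -> R)
    (nxt : S -> bool -> S) (H H' : S -> R) (n : nat) (s : S) :
  (forall t, 0 <= pr t <= 1) -> (forall t, H t <= H' t) ->
  expect pr nxt n s H <= expect pr nxt n s H'.
Proof.
move=> pr01 HH'; elim: n s => [|n IH] s //=; have /andP[p0 p1] := pr01 s.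
by apply: lerD; apply: ler_wpM2l => //; rewrite subr_ge0.
Qed.

Lemma expect_cst (R : realFieldType) (S : Type) (pr : S -> R)
    (nxt : S -> bool -> S) (c : R) (n : nat) (s : S) :
  expect pr nxt n s (fun=> c) = c.
Proof. by elim: n s => //= n IH s; rewrite !IH -mulrDl addrC subrK mul1r. Qed.

Lemma expect_add (R : realFieldType) (S : Type) (pr : S -> R)
    (nxt : S -> bool -> S) (H H' : S -> R) (n : nat) (s : S) :
  expect pr nxt n s (fun t => H t + H' t) = expect pr nxt n s H + expect pr nxt n s H'.
Proof. by elim: n s => //= n IH s; rewrite !IH; ring. Qed.

(** A function of the chain that is itself a Markov chain can be used to compute
    the expectations. *)
Lemma expect_sim (R : realFieldType) (S S' : Type) (pr : S -> R) (pr' : S' -> R)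
    (nxt : S -> bool -> S) (nxt' : S' -> bool -> S') (f : S -> S')
    (H : S' -> R) (n : nat) (s : S) :
  (forall t, pr t = pr' (f t)) ->
  (forall t b, f (nxt t b) = nxt' (f t) b) ->
  expect pr nxt n s (H \o f) = expect pr' nxt' n (f s) H.
Proof.
by move=> Hpr Hn; elim: n s => //= n IH s; rewrite !IH !Hn Hpr.
Qed.

(** The likelier outcome of a centred coin has the smaller value, so the other
    one bounds the variance; for the martingales below only left steps
    need then be estimated. *)
Lemma centered_coin_var (R : realFieldType) (r x y : R) :
  2^-1 <= r -> r <= 1 -> r * x + (1 - r) * y = 0 ->
  r * x ^+ 2 + (1 - r) * y ^+ 2 <= y ^+ 2.
Proof.
move=> r2 r1 h.
suff: r * (x ^+ 2 - y ^+ 2) <= 0 by lra.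
have r0 : 0 < r by lra.
apply: mulr_ge0_le0; first by lra.
have -> : x = - ((1 - r) / r * y).
  apply: (mulfI (lt0r_neq0 r0)).
  have -> : r * - ((1 - r) / r * y) = - ((1 - r) * y).
    by field; exact: lt0r_neq0.
  lra.
have k0 : 0 <= (1 - r) / r by apply: divr_ge0; lra.
have k1 : (1 - r) / r <= 1 by rewrite ler_pdivrMr //; lra.
have k2 : ((1 - r) / r) ^+ 2 <= 1 by rewrite expr_le1.
rewrite sqrrN exprMn; have := sqr_ge0 y; nra.
Qed.

(** The state [(s, j, v)] of the exploration: [s] sites are finished, and the
    current one has shown [v] lefts and still wants [j + 1] rights. *)
Definition xstate : Type := (nat * nat * nat)%type.

(** The right that finishes a site with [v] lefts leads to a site where [v + 1]
    rights are wanted. *)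
Definition xnext (st : xstate) (b : bool) : xstate :=
  let: (s, j, v) := st in
  if b then (if j is j'.+1 then (s, j', v) else (s.+1, v, 0%N))
  else (s, j, v.+1).

(** The first left eats the cookie, which is thus present exactly when [v = 0]. *)
Definition xprob (R : realFieldType) (p : R) (st : xstate) : R :=
  if st.2 == 0%N then p else 2^-1.

Definition xwidth (st : xstate) : nat := (st.1.2 + st.2).+1.

(** For [v > 0] the formula combines the two fair-coin martingales
    [w] and [w ^ 2 + 2 (j + 1)] of the width [w = v + j + 1], and the
    difference [j - v], which turns the number of lefts read so far into the
    number of coins.  The value at [v = 0] is the solution of the recursion in
    [j] that the cookie coin imposes, and the coefficients are chosen so that it
    also matches the values met when a new site is started. *)
Definition corrector (R : realFieldType) (p : R) (st : xstate) : R :=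
  let: (s, j, v) := st in
  if v is 0%N then (1 - p) * j%:R ^+ 2 + (2 - p) * j%:R + 4 * (1 - p)
  else (1 - p) * ((v + j + 1)%:R ^+ 2 + 2 * (j + 1)%:R)
       + (2 - 3 * (1 - p)) * (v + j + 1)%:R
       + (4 * p - 3) * (j%:R - v%:R).

Definition sites (st : xstate) : nat := st.1.1.

(** Every coin increases the expectation of [sites - corrector] by the same
    amount [4 p - 3], whatever the state. *)
Lemma corrector_martingale (R : realFieldType) (p : R) (st : xstate) :
  xprob p st * ((sites (xnext st true))%:R - corrector p (xnext st true))
  + (1 - xprob p st) * ((sites (xnext st false))%:R - corrector p (xnext st false))
  = (sites st)%:R - corrector p st + (4 * p - 3).
Proof.
case: st => [[s j] v]; rewrite /xprob /xnext /sites /=.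
by case: j => [|j]; case: v => [|v] /=; field.
Qed.

Lemma xprob_bounds (R : realFieldType) (p : R) (st : xstate) :
  3 / 4 <= p -> p < 1 -> 2^-1 <= xprob p st <= 1.
Proof. move=> p34 p1; rewrite /xprob; case: ifP => _; lra. Qed.

Lemma corrector_bound (R : realFieldType) (p : R) (st : xstate) :
  3 / 4 <= p -> p < 1 -> `|corrector p st| <= 8 * (xwidth st)%:R ^+ 2.
Proof.
move=> p34 p1; case: st => [[s j] v]; rewrite /xwidth /=.
have j0 : 0 <= j%:R :> R by [].
case: v => [|v] /=.
  rewrite addn0 -[j.+1%:R]natr1 ler_norml; set x := j%:R in j0 *; nra.
have -> : (v.+1 + j + 1)%:R = v%:R + j%:R + 2 :> R by ring.
have -> : (j + v.+1).+1%:R = v%:R + j%:R + 2 :> R by ring.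
have -> : (j + 1)%:R = j%:R + 1 :> R by ring.
rewrite -[v.+1%:R]natr1.
have v0 : 0 <= v%:R :> R by [].
rewrite ler_norml; set x := j%:R in j0 *; set y := v%:R in v0 *.
have xy : 0 <= x * y by apply: mulr_ge0.
apply/andP; split; nra.
Qed.

Lemma corrector_stepL (R : realFieldType) (p : R) (st : xstate) :
  3 / 4 <= p -> p < 1 ->
  `|corrector p (xnext st false) - corrector p st + (4 * p - 3)| <= 16 * (xwidth st)%:R.
Proof.
move=> p34 p1; case: st => [[s j] v]; rewrite /xwidth /=.
have j0 : 0 <= j%:R :> R by [].
case: v => [|v] /=; rewrite ler_norml.
  have -> : (1 + j + 1)%:R = j%:R + 2 :> R by ring.
  have -> : (j + 0).+1%:R = j%:R + 1 :> R by ring.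
  have -> : (j + 1)%:R = j%:R + 1 :> R by ring.
  set x := j%:R in j0 *; apply/andP; split; nra.
have -> : (v.+2 + j + 1)%:R = v%:R + j%:R + 3 :> R by ring.
have -> : (v.+1 + j + 1)%:R = v%:R + j%:R + 2 :> R by ring.
have -> : (j + v.+1).+1%:R = v%:R + j%:R + 2 :> R by ring.
have -> : (j + 1)%:R = j%:R + 1 :> R by ring.
have -> : v.+1%:R = v%:R + 1 :> R by ring.
have -> : v.+2%:R = v%:R + 2 :> R by ring.
have v0 : 0 <= v%:R :> R by [].
set x := j%:R in j0 *; set y := v%:R in v0 *.
apply/andP; split; nra.
Qed.

(** * A potential of order 2 + beta for the exploration chain *)

(** A substitute for [n ^ beta] whose sums and differences have closed forms. *)
Fixpoint growth (R : realFieldType) (beta : R) (n : nat) : R :=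
  if n is m.+1 then growth beta m * (1 + beta / m.+1%:R) else 1.

(** The second antidifference of [growth beta], of order [n ^ (2 + beta)]. *)
Fixpoint growth2 (R : realFieldType) (beta : R) (n : nat) : R :=
  if n is m.+1 then growth2 beta m + m%:R * growth beta m / (1 + beta) else 0.

Lemma growth_ge1 (R : realFieldType) (beta : R) (n : nat) :
  0 <= beta -> 1 <= growth beta n.
Proof.
move=> b0; elim: n => //= n IH.
have h : 0 <= beta / n.+1%:R by apply: divr_ge0.
by apply: (le_trans IH); rewrite ler_peMr ?lerDl // (le_trans ler01).
Qed.

Lemma growth_ge0 (R : realFieldType) (beta : R) (n : nat) :
  0 <= beta -> 0 <= growth beta n.
Proof. by move=> b0; apply: le_trans (growth_ge1 n b0). Qed.

Lemma growthS (R : realFieldType) (beta : R) (n : nat) :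
  n.+1%:R * growth beta n.+1 = (n.+1%:R + beta) * growth beta n.
Proof.
have n0 : n.+1%:R != 0 :> R by rewrite pnatr_eq0.
by rewrite /= mulrCA mulrDr mulr1 mulrCA divff // mulr1 mulrC.
Qed.

Lemma growth_le (R : realFieldType) (beta : R) (m n : nat) :
  0 <= beta -> (m <= n)%N -> growth beta m <= growth beta n.
Proof.
move=> b0 /subnK <-; elim: (n - m)%N => // k IH; rewrite addSn /=.
have h : 0 <= beta / (k + m).+1%:R by apply: divr_ge0.
have h1 := growth_ge1 (k + m) b0.
by apply: (le_trans IH); rewrite ler_peMr ?lerDl // (le_trans ler01).
Qed.

(** Since [n * growth n] has difference [(1 + beta) * growth n], one summation
    of [growth] is explicit, and [growth2] is the sum of these sums. *)
Lemma growth2_diff2 (R : realFieldType) (beta : R) (n : nat) : 0 <= beta ->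
  growth2 beta n.+2 - 2 * growth2 beta n.+1 + growth2 beta n = growth beta n.
Proof.
move=> b0; have bN : 1 + beta != 0 by rewrite gt_eqF //; lra.
have e : n.+1%:R * growth beta n.+1 = (n.+1%:R + beta) * growth beta n by exact: growthS.
have -> : growth2 beta n.+2 = growth2 beta n.+1 + n.+1%:R * growth beta n.+1 / (1 +
  beta) by [].
have -> : growth2 beta n.+1 = growth2 beta n + n%:R * growth beta n / (1 + beta) by [].
rewrite e; field; exact: bN.
Qed.

Lemma growth_concave (R : realFieldType) (beta : R) (n : nat) :
  0 <= beta <= 1 -> growth beta n + growth beta n.+2 <= 2 * growth beta n.+1.
Proof.
move=> /andP[b0 b1].
have e1 := growthS beta n; have e2 := growthS beta n.+1.
have g1 := growth_ge1 n b0; have g2 := growth_ge1 n.+1 b0.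
move: e1 e2; rewrite -[n.+2%:R]natr1.
have : 0 < n.+1%:R :> R by [].
move: (n.+1%:R) (growth beta n) (growth beta n.+1) (growth beta n.+2) g1 g2.
move=> k x y z x1 y1 k0 e1 e2.
have h1 : k * (y - x) = beta * x by rewrite mulrBr e1; ring.
have h2 : (k + 1) * (z - y) = beta * y by rewrite mulrBr e2; ring.
have h3 : k * y <= (k + 1) * x by rewrite e1; nra.
have h4 : (k + 1) * k * (z - y) <= (k + 1) * k * (y - x).
  rewrite mulrAC h2 -mulrA h1; nra.
have kk : 0 < (k + 1) * k by nra.
by move: h4; rewrite ler_pM2l // => h4; lra.
Qed.

Lemma growth2_ge0 (R : realFieldType) (beta : R) (n : nat) :
  0 <= beta -> 0 <= growth2 beta n.
Proof.
move=> b0; elim: n => //= n IH; apply: addr_ge0 => //.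
apply: divr_ge0; last lra.
by apply: mulr_ge0 => //; exact: growth_ge0.
Qed.

Lemma growth2_le (R : realFieldType) (beta : R) (m n : nat) :
  0 <= beta -> (m <= n)%N -> growth2 beta m <= growth2 beta n.
Proof.
move=> b0 /subnK <-; elim: (n - m)%N => // k IH; rewrite addSn /=.
apply: (le_trans IH); rewrite lerDl; apply: divr_ge0; last lra.
by apply: mulr_ge0 => //; exact: growth_ge0.
Qed.

(** Only the upper half of the sum that defines [growth2] is kept. *)
Lemma growth2_lower (R : realFieldType) (beta : R) (k : nat) :
  0 <= beta <= 1 -> k%:R ^+ 2 * growth beta k / 2 <= growth2 beta (k + k).
Proof.
move=> /andP[b0 b1].
suff H i : i%:R * (k%:R * growth beta k) / 2 <= growth2 beta (i + k).
  by apply: le_trans (H k); rewrite mulrA expr2.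
elim: i => [|i IH]; first by rewrite !mul0r growth2_ge0.
rewrite addSn /= -[i.+1%:R]natr1.
have g1 := growth_ge1 k b0; have g2 : growth beta k <= growth beta (i + k).
  by apply: growth_le => //; apply: leq_addl.
have kk : (k%:R : R) <= (i + k)%:R by rewrite ler_nat leq_addl.
have k0 : 0 <= k%:R :> R by [].
have : k%:R * growth beta k / 2 <= (i + k)%:R * growth beta (i + k) / (1 + beta).
  have h : k%:R * growth beta k <= (i + k)%:R * growth beta (i + k) by apply: ler_pM =>
    //; lra.
  have h0 : 0 <= k%:R * growth beta k by apply: mulr_ge0 => //; lra.
  rewrite ler_pdivlMr; last lra.
  rewrite mulrAC ler_pdivrMr //; nra.
lra.
Qed.

(** For [beta = 1 / (r + 1)] Bernoulli's inequality applied to each factor makes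
    the product of the [(r + 1)]-th powers telescope. *)
Lemma growth_root (R : realFieldType) (r n : nat) :
  n.+1%:R <= growth (r.+1%:R^-1 : R) n ^+ r.+1.
Proof.
elim: n => [|n IH]; first by rewrite expr1n.
rewrite [growth _ n.+1]/= exprMn.
set x : R := r.+1%:R^-1 / n.+1%:R.
have x0 : 0 <= x by rewrite divr_ge0 // invr_ge0.
have bern k : 1 + k%:R * x <= (1 + x) ^+ k.
  elim: k => [|k IHk]; first by rewrite mul0r addr0 expr0.
  rewrite exprS -[k.+1%:R]natr1.
  have kx : 0 <= k%:R * x by apply: mulr_ge0.
  nra.
have h : n.+2%:R = n.+1%:R * (1 + r.+1%:R * x) :> R.
  rewrite -[n.+2%:R]natr1 /x mulVKf ?pnatr_eq0 //.
  by rewrite mulrDr mulr1 divff ?pnatr_eq0.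
rewrite h; apply: ler_pM => //.
by apply: addr_ge0 => //; apply: mulr_ge0.
Qed.

(** For a fair coin the convexity of [growth2] is compensated by the expected
    loss of half a wanted right, each of which is valued [growth]. *)
Definition potential (R : realFieldType) (beta : R) (st : xstate) : R :=
  let: (s, j, v) := st in
  if v is 0%N then growth2 beta j
  else growth2 beta (v + j).+1 + j.+1%:R * growth beta (v + j).+1.

Lemma potential_ge0 (R : realFieldType) (beta : R) (st : xstate) :
  0 <= beta -> 0 <= potential beta st.
Proof.
move=> b0; case: st => [[s j] [|v]]; rewrite /potential; first exact: growth2_ge0.
apply: addr_ge0; first exact: growth2_ge0.
by apply: mulr_ge0 => //; exact: growth_ge0.
Qed.

Lemma potential_wide (R : realFieldType) (beta : R) (st : xstate) (K : nat) :
  0 <= beta -> (K < xwidth st)%N -> growth2 beta K <= potential beta st.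
Proof.
move=> b0; case: st => [[s j] [|v]];
  rewrite /potential /xwidth ltnS [_.1.2]/= [_.2]/= => Kw.
  by apply: growth2_le => //; rewrite addn0 in Kw.
apply: (@le_trans _ _ (growth2 beta (v.+1 + j).+1)).
  by apply: growth2_le => //; lia.
by rewrite lerDl; apply: mulr_ge0 => //; exact: growth_ge0.
Qed.

(** With a fair coin the drift is non-positive because [growth] is concave.
    With a cookie the drift is at most [growth j * (4 - eta * j)], where
    [eta > 0] is the hypothesis [(4 + beta) * (1 - p) < 1]; it is bounded because
    it is negative for large [j]. *)
Lemma potential_drift (R : archiRealFieldType) (beta p : R) :
  0 <= beta <= 1 -> p <= 1 -> (4 + beta) * (1 - p) < 1 ->
  exists2 C : R, 0 <= C & forall st : xstate,
    xprob p st * potential beta (xnext st true)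
    + (1 - xprob p st) * potential beta (xnext st false)
    <= potential beta st + C.
Proof.
move=> /[dup] b01 /andP[b0 b1] p1 hp.
have bN : 0 < 1 + beta by lra.
pose eta : R := (1 - 3 * (1 - p)) / (1 + beta) - (1 - p).
have eta0 : 0 < eta by rewrite subr_gt0 ltr_pdivlMr //; lra.
pose e (j : nat) : R := growth beta j * (4 - eta * j%:R).
have [C C0 eC] : exists2 C : R, 0 <= C & forall j, e j <= C.
  have [W hW] : exists W : nat, forall j, (W <= j)%N -> e j <= 0.
    exists (Num.bound (4 / eta)) => j Wj.
    apply: mulr_ge0_le0; first exact: growth_ge0.
    have : 4 / eta < j%:R.
      apply: (@lt_le_trans _ _ (Num.bound (4 / eta))%:R); last by rewrite ler_nat.
      by apply: archi_boundP; apply: divr_ge0; lra.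
    rewrite ltr_pdivrMr // mulrC; lra.
  exists (\sum_(j < W) `|e j|); first exact: sumr_ge0.
  move=> j; case: (ltnP j W) => [jW|/hW ej]; last first.
    by apply: (le_trans ej); apply: sumr_ge0.
  rewrite (bigD1 (Ordinal jW)) //=.
  apply: (le_trans (ler_norm _)); rewrite lerDl; exact: sumr_ge0.
exists C => // -[[s j] v].
case: v => [|v]; last first.
  have h : potential beta (xnext (s, j, v.+1) true)
      = growth2 beta (v + j).+1 + j%:R * growth beta (v + j).+1.
    by case: j => [|j] /=; rewrite ?mul0r ?addr0 ?addn0 // addnS.
  have d := growth2_diff2 (v + j).+1 b0.
  have c := growth_concave (v + j).+1 b01.
  have hj : 0 <= j%:R :> R by [].
  have -> : xprob p (s, j, v.+1) = 2^-1 by [].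
  rewrite h /potential [xnext _ false]/= !addSn -[j.+1%:R]natr1.
  move: d c; set A := growth2 beta _; set B := growth2 beta _.
  set D := growth2 beta _; set x := growth beta _; set y := growth beta _.
  set z := growth beta _ => d c.
  have : j%:R * (x + y) <= j%:R * (2 * z) by apply: ler_wpM2l.
  lra.
have -> : xprob p (s, j, 0%N) = p by [].
have -> : potential beta (xnext (s, j, 0%N) true) = growth2 beta j.-1 by case: j.
have -> : potential beta (xnext (s, j, 0%N) false)
    = growth2 beta j.+2 + j.+1%:R * growth beta j.+2 by [].
have -> : potential beta (s, j, 0%N) = growth2 beta j by [].
apply: le_trans (_ : growth2 beta j + e j <= _); last by rewrite lerD2l; exact: eC.
have q0 : 0 <= 1 - p by lra.
case: j => [|j].
  rewrite /e /= !mul0r !add0r.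
  have -> : 1 * (1 * (1 + beta / 1)) / (1 + beta) = 1.
    by field; rewrite gt_eqF.
  have bq : beta * (1 - p) <= 1 - p by rewrite ler_piMl.
  have bbq : beta * (beta * (1 - p)) <= beta * (1 - p) by rewrite ler_piMl // mulr_ge0.
  lra.
have d0 := growth2_diff2 j b0; have d1 := growth2_diff2 j.+1 b0.
have D : growth2 beta j.+2 = growth2 beta j.+1 + j.+1%:R * growth beta j.+1 / (1 +
  beta) by [].
have g1 := growthS beta j.+1; have g2 := growthS beta j.+2.
have l0 : growth beta j <= growth beta j.+1 by apply: growth_le.
have pp := growth_ge0 j b0; have p0 := growth_ge0 j.+1 b0; have p1' := growth_ge0 j.+2 b0.
have j0 : 0 <= j%:R :> R by [].
rewrite /e /eta [j.+1.-1]/=.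
have -> : growth beta j.+1 * (4 - ((1 - 3 * (1 - p)) / (1 + beta) - (1 - p)) * j.+1%:R)
  = 4 * growth beta j.+1 - (1 - 3 * (1 - p)) * (growth2 beta j.+2 - growth2 beta j.+1)
    + (1 - p) * (j.+1%:R * growth beta j.+1).
  rewrite D; field; rewrite gt_eqF //.
have e3 : j.+3%:R = j%:R + 3 :> R by ring.
have e2 : j.+2%:R = j%:R + 2 :> R by ring.
have e1 : j.+1%:R = j%:R + 1 :> R by ring.
rewrite e3 in g2; rewrite e2 in g1; rewrite e2 e1.
move: d0 d1 g1 g2 l0 pp p0 p1' j0 {D eC e3 e2 e1}.
move: (growth beta j) (growth beta j.+1) (growth beta j.+2) (growth beta j.+3) (j%:R).
move: (growth2 beta j) (growth2 beta j.+1) (growth2 beta j.+2) (growth2 beta j.+3).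
move=> A0 A1 A2 A3 x0 x1 x2 x3 k d0 d1 g1 g2 l0 pp p0 p1' k0.
have h2 : x2 <= 2 * x1.
  have : (k + 2) * x2 <= (k + 2) * (2 * x1) by rewrite g1; nra.
  by rewrite ler_pM2l //; lra.
have h3 : (k + 2) * x3 <= (k + 5) * x1.
  apply: (@le_trans _ _ ((k + 3) * x2)); last by nra.
  have : (k + 3) * ((k + 2) * x3) <= (k + 3) * ((k + 3) * x2).
    rewrite mulrCA g2 !mulrA ler_wpM2r //; nra.
  by rewrite ler_pM2l //; lra.
have hq : (1 - p) * ((k + 2) * x3) <= (1 - p) * ((k + 5) * x1) by apply: ler_wpM2l.
have px : p * x0 <= x1 by apply: (le_trans _ l0); rewrite ler_piMl.
nra.
Qed.

(** * Concentration of the number of explored sites *)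

(** Chebyshev's inequality for [sites - corrector], stopped when the width
    exceeds [K].  The first term bounds the variance accumulated
    before that, with increments at most [16 * K]; the second bounds the
    probability of ever being that wide by the growth of the potential.
    Both are propagated together by induction on the number of coins. *)
Lemma explore_tail (R : realFieldType) (p beta C m c : R) (K n : nat) (st : xstate) :
  3 / 4 <= p -> p < 1 -> 0 <= beta -> 0 <= C ->
  (forall t : xstate, xprob p t * potential beta (xnext t true)
    + (1 - xprob p t) * potential beta (xnext t false) <= potential beta t + C) ->
  0 < m -> 8 * K%:R ^+ 2 <= m -> 0 < growth2 beta K ->
  expect (xprob p) xnext n st (fun t => (2 * m <= `|(sites t)%:R - c|)%R%:R)
  <= (((sites st)%:R - corrector p st - (c - n%:R * (4 * p - 3))) ^+ 2
        + (16 * K%:R) ^+ 2 * n%:R) / m ^+ 2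
     + (potential beta st + C * n%:R) / growth2 beta K.
Proof.
move=> p34 p1 b0 C0 drift m0 Km A0.
have m2 : 0 < m ^+ 2 by rewrite exprn_gt0.
have K20 : 0 <= K%:R ^+ 2 :> R by rewrite sqr_ge0.
have first0 k (x : R) : 0 <= (x ^+ 2 + (16 * K%:R) ^+ 2 * k%:R) / m ^+ 2.
  apply: divr_ge0; last exact: ltW.
  by apply: addr_ge0; [exact: sqr_ge0|apply: mulr_ge0 => //; exact: sqr_ge0].
have second0 k t : 0 <= (potential beta t + C * k%:R) / growth2 beta K.
  apply: divr_ge0; last exact: ltW.
  by apply: addr_ge0; [exact: potential_ge0|apply: mulr_ge0].
have xp01 t : 0 <= xprob p t <= 1.
  by have /andP[h1 h2] := xprob_bounds t p34 p1; apply/andP; split; lra.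
(* at a wide state the potential alone makes the bound larger than one *)
have wide k t : (K < xwidth t)%N -> expect (xprob p) xnext k t (fun t => (2 * m <=
  `|(sites t)%:R - c|)%R%:R)
    <= (potential beta t + C * k%:R) / growth2 beta K.
  move=> Kt; apply: (@le_trans _ _ 1).
    rewrite -[leRHS](expect_cst (xprob p) xnext 1 k t); apply: expect_mono => // u.
    by rewrite lern1 leq_b1.
  rewrite ler_pdivlMr // mul1r; apply: (le_trans (potential_wide b0 Kt)).
  by rewrite lerDl; apply: mulr_ge0.
elim: n st => [|n IH] st.
  have [Kt|Kt] := ltnP K (xwidth st).
    by apply: (le_trans (wide 0%N st Kt)); rewrite lerDr.
  rewrite /= mul0r subr0 !mulr0 !addr0.
  case: (lerP (2 * m)) => [far|_]; last first.
    by have := first0 0%N ((sites st)%:R - corrector p st - c); have := second0 0%N st;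
      rewrite !mulr0 !addr0 => h1 h2; apply: addr_ge0.
  have : 1 <= ((sites st)%:R - corrector p st - c) ^+ 2 / m ^+ 2; last first.
    move=> h; rewrite -[leLHS]addr0; apply: lerD => //.
    by have := second0 0%N st; rewrite mulr0 addr0.
  rewrite ler_pdivlMr // mul1r -[leRHS]real_normK ?num_real //.
  rewrite ler_pXn2r ?nnegrE ?(ltW m0) //.
  have cb : `|corrector p st| <= m.
    apply: (le_trans (corrector_bound st p34 p1)); apply: le_trans Km.
    by rewrite ler_pM2l // ler_pXn2r ?nnegrE // ler_nat.
  have : `|(sites st)%:R - c| <= `|(sites st)%:R - corrector p st - c| + `|corrector p st|.
    apply: le_trans (ler_normD _ _); rewrite le_eqVlt; apply/orP; left; apply/eqP;
      congr `|_|; ring.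
  lra.
have [Kt|Kt] := ltnP K (xwidth st).
  by apply: (le_trans (wide n.+1 st Kt)); rewrite lerDr.
have /andP[r0 r1] := xprob_bounds st p34 p1.
have := corrector_martingale p st; have := corrector_stepL st p34 p1; have := drift st.
rewrite [expect _ _ _ _ _]/=.
have := IH (xnext st true); have := IH (xnext st false).
have sL : sites (xnext st false) = sites st by case: st {IH wide Kt r0 r1} => [[s j] v].
rewrite sL.
set r := xprob p st in r0 r1 *.
set EL := expect _ _ _ _ _; set ER := expect _ _ _ _ _.
set FL := potential beta (xnext st false); set FR := potential beta (xnext st true).
set gL := corrector p (xnext st false); set gR := corrector p (xnext st true).
set F := potential beta st; set g := corrector p st.
set s := (sites st)%:R; set s' := (sites (xnext st true))%:R.
move=> hL hR dr stp mart.
have Kw : (xwidth st)%:R <= K%:R :> R by rewrite ler_nat.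
pose y : R := - (gL - g + (4 * p - 3)).
pose x : R := s' - gR - s + g - (4 * p - 3).
have xy : r * x + (1 - r) * y = 0 by rewrite /x /y; lra.
have vr := centered_coin_var r0 r1 xy.
have y2 : y ^+ 2 <= (16 * K%:R) ^+ 2.
  rewrite /y sqrrN -[leLHS]real_normK ?num_real //.
  rewrite ler_pXn2r ?nnegrE ?mulr_ge0 //; apply: (le_trans stp); lra.
pose Y : R := s - g - (c - n.+1%:R * (4 * p - 3)).
have YR : s' - gR - (c - n%:R * (4 * p - 3)) = Y + x by rewrite /Y /x; ring.
have YL : s - gL - (c - n%:R * (4 * p - 3)) = Y + y by rewrite /Y /y; ring.
rewrite YR in hR; rewrite YL in hL; rewrite -/Y.
apply: (@le_trans _ _ (r * (((Y + x) ^+ 2 + (16 * K%:R) ^+ 2 * n%:R) / m ^+ 2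
     + (FR + C * n%:R) / growth2 beta K)
   + (1 - r) * (((Y + y) ^+ 2 + (16 * K%:R) ^+ 2 * n%:R) / m ^+ 2
     + (FL + C * n%:R) / growth2 beta K))).
  by apply: lerD; apply: ler_wpM2l => //; lra.
have -> : r * (((Y + x) ^+ 2 + (16 * K%:R) ^+ 2 * n%:R) / m ^+ 2
     + (FR + C * n%:R) / growth2 beta K)
   + (1 - r) * (((Y + y) ^+ 2 + (16 * K%:R) ^+ 2 * n%:R) / m ^+ 2
     + (FL + C * n%:R) / growth2 beta K)
  = (Y ^+ 2 + 2 * Y * (r * x + (1 - r) * y) + (r * x ^+ 2 + (1 - r) * y ^+ 2)
      + (16 * K%:R) ^+ 2 * n%:R) / m ^+ 2
    + (r * FR + (1 - r) * FL + C * n%:R) / growth2 beta K by ring.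
rewrite xy mulr0 addr0 -[n.+1%:R]natr1.
apply: lerD; rewrite ler_pM2r ?invr_gt0 //; lra.
Qed.

(** With [k = L ^ (4 (r + 1))] and [n = k ^ 2 * L ^ 2] the width bound is
    [K = 2 k].  Then [K ^ 2 / n] is of order [1 / L ^ 2], while the potential at
    [K] is of order [k ^ 2 * k ^ (1 / (r + 1)) >= k ^ 2 * L ^ 4], that is, at
    least [n * L ^ 2]. *)
Lemma explore_concentration (R : archiRealFieldType) (p : R) :
  3 / 4 < p -> p < 1 ->
  exists2 M : nat, (1 < M)%N & forall eps : R, 0 < eps ->
  exists (C : R) (L0 : nat), forall L : nat, (L0 <= L)%N -> 
  expect (xprob p) xnext (L ^ M) (0%N, 0%N, 0%N)
    (fun t => (eps * (L ^ M)%:R <= `|(sites t)%:R - (4 * p - 3) * (L ^ M)%:R|)%R%:R)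
  <= C / L%:R ^+ 2.
Proof.
move=> p34 p1.
have [r hr] : exists r : nat, r.+1%:R^-1 < 4 * p - 3.
  exists (Num.bound (4 * p - 3)^-1); rewrite invf_plt ?posrE //; last lra.
  apply: (@lt_trans _ _ (Num.bound (4 * p - 3)^-1)%:R); last by rewrite ltr_nat.
  by apply: archi_boundP; rewrite invr_ge0; lra.
pose beta : R := r.+1%:R^-1.
have b0 : 0 <= beta by rewrite invr_ge0.
have b1 : beta <= 1 by rewrite invf_le1 // ler1n.
have b01 : 0 <= beta <= 1 by rewrite b0 b1.
have q0 : 0 < 1 - p by lra.
have hp : (4 + beta) * (1 - p) < 1.
  have : beta * (1 - p) <= beta by rewrite ler_piMr //; lra.
  rewrite -/beta in hr; lra.
have [D D0 drift] := potential_drift b01 (ltW p1) hp.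
exists (8 * r.+1 + 2)%N; first by rewrite addn2.
move=> eps e0.
exists (4 / eps ^+ 2 + (64 / eps) ^+ 2 + 2 * D), (Num.bound (64 / eps)).+1 => L hL.
have L1 : (1 <= L)%N by apply: leq_trans hL.
have LR : 1 <= L%:R :> R by rewrite ler1n.
have LR0 : 0 < L%:R :> R by lra.
have L64 : 64 / eps <= L%:R.
  apply: ltW; apply: (@lt_le_trans _ _ (Num.bound (64 / eps))%:R).
    by apply: archi_boundP; rewrite divr_ge0 // ltW.
  by rewrite ler_nat; apply: leq_trans hL.
have [k kE] : exists k, k = (L ^ (4 * r.+1))%N by eexists.
have [n nN] : exists n, n = (L ^ (8 * r.+1 + 2))%N by eexists.
rewrite -nN.
have nE : n%:R = k%:R ^+ 2 * L%:R ^+ 2 :> R.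
  rewrite -!natrX -natrM; congr _%:R.
  by rewrite nN kE -expnM -expnD; congr (_ ^ _)%N; rewrite -mulnA (mulnC r.+1) mulnA.
have k1 : (1 <= k)%N by rewrite kE expn_gt0 L1.
have kR : 1 <= k%:R :> R by rewrite ler1n.
have L20 : 0 < L%:R ^+ 2 :> R by rewrite exprn_gt0 //; lra.
have k20 : 0 < k%:R ^+ 2 :> R by rewrite exprn_gt0 //; lra.
have n0 : 0 < n%:R :> R by rewrite nE mulr_gt0.
have bk : L%:R ^+ 4 <= growth beta k.
  have := growth_root R r k; rewrite -/beta => h.
  rewrite -(@ler_pXn2r _ r.+1) ?nnegrE ?exprn_ge0 ?growth_ge0 //.
  apply: le_trans h; by rewrite -exprM -natrX ler_nat -kE leqnSn.
have AK := growth2_lower k b01.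
have A0 : k%:R ^+ 2 * L%:R ^+ 4 / 2 <= growth2 beta (k + k).
  apply: le_trans AK; rewrite ler_pM2r ?invr_gt0 // ler_pM2l //.
have L40 : 0 < L%:R ^+ 4 :> R by rewrite exprn_gt0 //; lra.
have A1 : 0 < k%:R ^+ 2 * L%:R ^+ 4 / 2 :> R by rewrite divr_gt0 // mulr_gt0.
have A2 : 0 < growth2 beta (k + k) by apply: lt_le_trans A0.
pose m : R := eps * n%:R / 2.
have m0 : 0 < m by rewrite divr_gt0 // mulr_gt0.
have Km : 8 * (k + k)%:R ^+ 2 <= m.
  rewrite /m nE natrD.
  have : 64 <= eps * L%:R ^+ 2.
    move: L64; rewrite ler_pdivrMr // mulrC => h; apply: (le_trans h).
    by rewrite ler_pM2l // expr2 ler_peMr //; lra.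
  nra.
have := @explore_tail R p beta D m ((4 * p - 3) * n%:R) (k + k) n (0%N, 0%N, 0%N) (ltW
  p34) p1 b0 D0 drift m0 Km A2.
have -> : 2 * m = eps * n%:R by rewrite /m; field.
move=> h; apply: (le_trans h).
rewrite {h} /sites [potential _ _]/= !add0r.
have -> : corrector p (0%N, 0%N, 0%N) = 4 * (1 - p) by rewrite /=; ring.
have -> : - (4 * (1 - p)) - ((4 * p - 3) * n%:R - n%:R * (4 * p - 3)) = - (4 * (1 - p))
  by ring.
rewrite [X in X + _]mulrDl [leRHS]mulrDl [X in _ <= X + _]mulrDl.
apply: lerD; first apply: lerD.
- have q1 : (- (4 * (1 - p))) ^+ 2 <= 1 by rewrite sqrrN expr_le1 //; lra.
  apply: (@le_trans _ _ (1 / m ^+ 2)).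
    by rewrite ler_pM2r // invr_gt0 exprn_gt0.
  have -> : 1 / m ^+ 2 = 4 / eps ^+ 2 * (1 / n%:R ^+ 2).
    by rewrite /m; field; rewrite !gt_eqF //.
  rewrite ler_pM2l ?divr_gt0 ?exprn_gt0 // mul1r lef_pV2 ?posrE ?exprn_gt0 //.
  rewrite ler_pXn2r ?nnegrE // ?(ltW n0) // ler_nat nN addn2 expnS.
  by rewrite leq_pmulr // expn_gt0 L1.
- have -> : (16 * (k + k)%:R) ^+ 2 * n%:R / m ^+ 2 = (64 / eps) ^+ 2 / L%:R ^+ 2.
    rewrite /m nE natrD; field; rewrite !gt_eqF //; lra.
  by [].
- apply: (@le_trans _ _ (D * n%:R / (k%:R ^+ 2 * L%:R ^+ 4 / 2))).
    by rewrite ler_wpM2l ?mulr_ge0 // lef_pV2 ?posrE.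
  rewrite nE le_eqVlt; apply/orP; left; apply/eqP.
  by field; rewrite !gt_eqF //; lra.
Qed.

(** * Monotonicity in the cookie strength *)

Definition reach_prob (R : realFieldType) (p : R) (N n : nat) (st : xstate) : R :=
  expect (xprob p) xnext n st (fun t => (N <= sites t)%N%:R).

Lemma reach_probS (R : realFieldType) (p : R) (N n : nat) (st : xstate) :
  reach_prob p N n.+1 st = xprob p st * reach_prob p N n (xnext st true)
    + (1 - xprob p st) * reach_prob p N n (xnext st false).
Proof. by []. Qed.

Lemma xprob01 (R : realFieldType) (p : R) (st : xstate) :
  2^-1 <= p -> p <= 1 -> 0 <= xprob p st <= 1.
Proof. by move=> h1 h2; rewrite /xprob; case: ifP => _; apply/andP; split; lra. Qed.

Lemma mix_le (R : realFieldType) (r a b c : R) :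
  0 <= r <= 1 -> a <= c -> b <= c -> r * a + (1 - r) * b <= c.
Proof. by move=> /andP[r0 r1] ac bc; nra. Qed.

Lemma reach_prob_time (R : realFieldType) (p : R) (N n : nat) (st : xstate) :
  2^-1 <= p -> p <= 1 -> reach_prob p N n st <= reach_prob p N n.+1 st.
Proof.
move=> p2 p1; elim: n st => [|n IH] st.
  rewrite reach_probS /reach_prob /=.
  have sR : (N <= sites st)%N%:R <= (N <= sites (xnext st true))%N%:R :> R.
    rewrite ler_nat; case: st => [[s [|j]] v] //=; rewrite /sites /=.
    by case: (leqP N s) => // Ns; rewrite (leq_trans Ns).
  have sL : sites (xnext st false) = sites st by case: st {sR} => [[s j] v].
  have /andP[r0 r1] := xprob01 st p2 p1.
  rewrite sL; nra.
rewrite reach_probS (reach_probS _ _ n.+1).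
have /andP[r0 r1] := xprob01 st p2 p1.
by apply: lerD; apply: ler_wpM2l => //; rewrite subr_ge0.
Qed.

(** Wanting fewer rights, having seen fewer lefts, and having just finished the
    current site are each an advantage.  The three claims need each other in
    the induction; the second one uses that a cookie favours right, which
    is the better outcome. *)
Lemma reach_prob_order (R : realFieldType) (p : R) (N n : nat) :
  2^-1 <= p -> p <= 1 ->
  [/\ forall s j v, reach_prob p N n (s, j.+1, v) <= reach_prob p N n (s, j, v),
      forall s j v, reach_prob p N n (s, j, v.+1) <= reach_prob p N n (s, j, v) &
      forall s v, reach_prob p N n (s, 0%N, v) <= reach_prob p N n (s.+1, v, 0%N)].
Proof.
move=> p2 p1; elim: n => [|n [Hj Hv Hc]].
  split=> [s j v|s j v|s v]; rewrite /reach_prob /sites //= ler_nat.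
  by case: (leqP N s) => // Ns; rewrite (leq_trans Ns).
have Rj s j v : reach_prob p N n (xnext (s, j.+1, v) true)
    <= reach_prob p N n (xnext (s, j, v) true).
  by case: j => [|j] /=; [exact: Hc|exact: Hj].
have Rv s j v : reach_prob p N n (xnext (s, j, v.+1) true)
    <= reach_prob p N n (xnext (s, j, v) true).
  by case: j => [|j] /=; [exact: Hj|exact: Hv].
have RL s j v : reach_prob p N n (xnext (s, j, v) false)
    <= reach_prob p N n (xnext (s, j, v) true).
  case: j => [|j] /=; first by apply: le_trans (Hv _ _ _) (Hc _ _).
  by apply: le_trans (Hj _ _ _) (Hv _ _ _).
split=> [s j v|s j v|s v]; rewrite ?reach_probS.
- have /andP[r0 r1] := xprob01 (s, j, v) p2 p1.
  have -> : xprob p (s, j.+1, v) = xprob p (s, j, v) by [].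
  by apply: lerD; apply: ler_wpM2l; rewrite ?subr_ge0 //; exact: Hj.
- have hL : reach_prob p N n (xnext (s, j, v.+1) false)
      <= reach_prob p N n (xnext (s, j, v) false) by exact: Hv.
  have hR := Rv s j v; have hRL := RL s j v.
  case: v hL hR hRL => [|v] hL hR hRL.
    rewrite [xprob p (s, j, 1%N)]/xprob [xprob p (s, j, 0%N)]/xprob /=.
    move: hL hR hRL => /=; nra.
  rewrite [xprob p (s, j, v.+2)]/xprob [xprob p (s, j, v.+1)]/xprob /=.
  by apply: lerD; apply: ler_wpM2l => //; rewrite ?subr_ge0; lra.
- rewrite -reach_probS; apply: (@le_trans _ _ (reach_prob p N n (s.+1, v, 0%N))).
    apply: mix_le; [exact: xprob01|by []|].
    exact: RL s 0%N v.
  exact: reach_prob_time.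
Qed.

(** Stronger cookies differ only in putting more weight on right, the better
    outcome by [reach_prob_order]. *)
Lemma reach_prob_mono (R : realFieldType) (p p' : R) (N n : nat) (st : xstate) :
  2^-1 <= p -> p <= p' -> p' <= 1 ->
  reach_prob p N n st <= reach_prob p' N n st.
Proof.
move=> p2 pp p1; elim: n st => [|n IH] // st.
have [Hj Hv Hc] := @reach_prob_order R p' N n (le_trans p2 pp) p1.
rewrite !reach_probS.
have hT := IH (xnext st true); have hF := IH (xnext st false).
case: st hT hF => [[s j] [|v]] hT hF; last first.
  have -> : xprob p (s, j, v.+1) = 2^-1 by [].
  have -> : xprob p' (s, j, v.+1) = 2^-1 by [].
  by apply: lerD; apply: ler_wpM2l => //; lra.
have -> : xprob p (s, j, 0%N) = p by [].
have -> : xprob p' (s, j, 0%N) = p' by [].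
have RL : reach_prob p' N n (xnext (s, j, 0%N) false)
    <= reach_prob p' N n (xnext (s, j, 0%N) true).
  case: j {hT hF} => [|j] /=; first by apply: le_trans (Hv _ _ _) (Hc _ _).
  by apply: le_trans (Hj _ _ _) (Hv _ _ _).
move: hT hF RL.
set a := reach_prob p _ _ _; set b := reach_prob p _ _ _.
set a' := reach_prob p' _ _ _; set b' := reach_prob p' _ _ _ => hT hF RL.
nra.
Qed.

(** * Reading the same stacks of coins in different orders *)

Definition stacks : Type := int -> seq bool.

(** Stacks are kept in the order of reading, so that later stacks extend earlier
    ones. *)
Definition push (eta : stacks) (k : int) (b : bool) : stacks :=
  fun i => if i == k then rcons (eta i) b else eta i.

Definition coin (R : realFieldType) (p : R) (eta : stacks) (k : int) : R :=
  if false \in eta k then 2^-1 else p.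

(** The law of the stacks themselves, at the sites and up to the depths listed in
    [ks]; all adaptive readings are compared with it. *)
Fixpoint read (R : realFieldType) (p : R) (ks : seq int) (eta : stacks)
    (F : stacks -> R) : R :=
  if ks is k :: ks' then
    coin p eta k * read p ks' (push eta k true) F
    + (1 - coin p eta k) * read p ks' (push eta k false) F
  else F eta.

Definition extends (eta zeta : stacks) : Prop := forall k, prefix (eta k) (zeta k).

Lemma coin01 (R : realFieldType) (p : R) (eta : stacks) (k : int) :
  2^-1 <= p -> p <= 1 -> 0 <= coin p eta k <= 1.
Proof. by move=> h1 h2; rewrite /coin; case: ifP => _; apply/andP; split; lra. Qed.

Lemma pushC (eta : stacks) (k k' : int) (b b' : bool) : k != k' ->
  push (push eta k b) k' b' = push (push eta k' b') k b.
Proof.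
move=> kk'; apply: funext => i; rewrite /push.
by case: (eqVneq i k) => [->|]; case: (eqVneq i k') => // ?; rewrite (negPf kk').
Qed.

Lemma coin_push (R : realFieldType) (p : R) (eta : stacks) (k k' : int) (b : bool) :
  k != k' -> coin p (push eta k b) k' = coin p eta k'.
Proof. by move=> kk'; rewrite /coin /push eq_sym (negPf kk'). Qed.

(** Coins at different sites are independent, so a reading can be brought
    forward. *)
Lemma read_first (R : realFieldType) (p : R) (k : int) (ks : seq int)
    (eta : stacks) (F : stacks -> R) :
  k \in ks -> read p ks eta F = read p (k :: rem k ks) eta F.
Proof.
elim: ks eta => // k' ks IH eta; rewrite inE [rem _ _]/=.
case: (eqVneq k k') => [->|kk'] //=.
move=> kin; rewrite !IH //=.
have k'k : k' != k by rewrite eq_sym.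
by rewrite !(coin_push _ _ _ kk') !(coin_push _ _ _ k'k) !(pushC _ _ _ k'k); ring.
Qed.

Lemma extends_push (eta zeta : stacks) (k : int) (b : bool) :
  extends (push eta k b) zeta -> extends eta zeta.
Proof.
move=> h i; have := h i; rewrite /push; case: ifP => // _.
by apply: prefix_trans; apply: prefix_rcons.
Qed.

Lemma read_le (R : realFieldType) (p : R) (ks : seq int) (eta : stacks)
    (F : stacks -> R) (c : R) : 2^-1 <= p -> p <= 1 ->
  (forall zeta, extends eta zeta -> F zeta <= c) -> read p ks eta F <= c.
Proof.
move=> p2 p1; elim: ks eta => [|k ks IH] eta h /=.
  by apply: h => k; apply: prefix_refl.
have /andP[c0 c1] := coin01 eta k p2 p1.
have hT : read p ks (push eta k true) F <= c.
  by apply: IH => z /extends_push; exact: h.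
have hF : read p ks (push eta k false) F <= c.
  by apply: IH => z /extends_push; exact: h.
nra.
Qed.

Lemma readN (R : realFieldType) (p : R) (ks : seq int) (eta : stacks)
    (F : stacks -> R) : read p ks eta (fun z => - F z) = - read p ks eta F.
Proof. by elim: ks eta => //= k ks IH eta; rewrite !IH; ring. Qed.

(** A strategy selects the next site to read from the coins read so far; words
    of coins are listed from the latest to the earliest. *)
Definition strategy : Type := seq bool -> int.

Fixpoint stk (site : strategy) (w : seq bool) : stacks :=
  if w is b :: w' then push (stk site w') (site w') b else fun=> [::].

Definition wnext (w : seq bool) (b : bool) : seq bool := b :: w.

Definition run_prob (R : realFieldType) (p : R) (site : strategy) (w : seq bool) : R :=
  coin p (stk site w) (site w).

(** Serves to choose a list of readings that no run of the strategy exhausts. *)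
Fixpoint reads (site : strategy) (n : nat) (w : seq bool) : seq int :=
  if n is m.+1 then
    site w :: reads site m (true :: w) ++ reads site m (false :: w)
  else [::].

(** A strategy followed by the reading of what is left of [ks] reads [ks]
    in another, adaptive, order.  The multiplicity condition says that [ks] is
    large enough for the strategy never to run out of coins. *)
Lemma read_run_le (R : realFieldType) (p : R) (site : strategy) (n : nat)
    (w : seq bool) (ks : seq int) (F : stacks -> R) (H : seq bool -> R) :
  2^-1 <= p -> p <= 1 ->
  all (fun k => (n <= count_mem k ks)%N) (reads site n w) ->
  (forall w' zeta, size w' = n -> extends (stk site (w' ++ w)) zeta ->
     F zeta <= H (w' ++ w)) ->
  read p ks (stk site w) F <= expect (run_prob p site) wnext n w H.
Proof.
move=> p2 p1; elim: n w ks => [|n IH] w ks hks hF.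
  by apply: read_le => // z; apply: (hF [::]).
move: hks => /= /andP[hw]; rewrite all_cat => /andP[hT hFa].
have wks : site w \in ks by rewrite -has_pred1 has_count; apply: leq_trans hw.
have less (b : bool) : all (fun k => (n < count_mem k ks)%N) (reads site n (b :: w)) ->
    all (fun k => (n <= count_mem k (rem (site w) ks))%N) (reads site n (b :: w)).
  apply: sub_all => k; rewrite count_rem wks /= => h.
  by case: (site w == k) => /=; rewrite ?subn1 ?subn0; lia.
have step (b : bool) : all (fun k => (n < count_mem k ks)%N) (reads site n (b :: w)) ->
   read p (rem (site w) ks) (stk site (b :: w)) F
   <= expect (run_prob p site) wnext n (b :: w) H.
  move=> hb; apply: IH; first exact: less.
  by move=> w' z sw' ext; rewrite -cat_rcons; apply: hF;
    rewrite ?size_rcons ?sw' // cat_rcons.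
rewrite (read_first _ _ _ wks) /=.
have /andP[c0 c1] := coin01 (stk site w) (site w) p2 p1.
apply: lerD; apply: ler_wpM2l => //; first exact: (step true).
  by rewrite subr_ge0.
exact: (step false).
Qed.

Lemma read_run_ge (R : realFieldType) (p : R) (site : strategy) (n : nat)
    (w : seq bool) (ks : seq int) (F : stacks -> R) (H : seq bool -> R) :
  2^-1 <= p -> p <= 1 ->
  all (fun k => (n <= count_mem k ks)%N) (reads site n w) ->
  (forall w' zeta, size w' = n -> extends (stk site (w' ++ w)) zeta ->
     H (w' ++ w) <= F zeta) ->
  expect (run_prob p site) wnext n w H <= read p ks (stk site w) F.
Proof.
move=> p2 p1 hks hF; rewrite -[leRHS]opprK lerNr -readN.
have -> : - expect (run_prob p site) wnext n w H
    = expect (run_prob p site) wnext n w (fun w => - H w).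
  by elim: n w {hks hF} => //= n IH w; rewrite -!IH; ring.
by apply: read_run_le => // w' z sw' ext; rewrite lerN2; apply: hF.
Qed.

(** Both strategies are completed to readings of one list large enough for
    both, and under this common law the event [C] of the stacks lies
    between [A] and [B]. *)
Lemma strategy_comparison (R : realFieldType) (p : R) (siteA siteB : strategy)
    (n : nat) (C : stacks -> Prop) (A B : seq bool -> bool) :
  2^-1 <= p -> p <= 1 ->
  (forall w zeta, size w = n -> A w -> extends (stk siteA w) zeta -> C zeta) ->
  (forall w zeta, size w = n -> extends (stk siteB w) zeta -> C zeta -> B w) ->
  expect (run_prob p siteA) wnext n [::] (fun w => (A w)%:R)
  <= expect (run_prob p siteB) wnext n [::] (fun w => (B w)%:R).
Proof.
move=> p2 p1 hA hB.
pose ks := flatten (nseq n (reads siteA n [::] ++ reads siteB n [::])).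
have cnt k : k \in reads siteA n [::] ++ reads siteB n [::] -> (n <= count_mem k ks)%N.
  rewrite -has_pred1 has_count /ks; move: (_ ++ _) => s hs.
  elim: {ks hA hB} n => //= m IH; rewrite count_cat.
  by apply: leq_trans (leq_add hs IH).
pose F (z : stacks) : R := `[< C z >]%:R.
apply: (@le_trans _ _ (read p ks (fun=> [::]) F)).
  apply: (@read_run_ge R p siteA n [::] ks F) => //.
    by apply/allP => k kin; apply: cnt; rewrite mem_cat kin.
  move=> w' z sw'; rewrite cats0 => ext; rewrite /F ler_nat.
  by case: (boolP (A w')) => // Aw; rewrite asboolT //; apply: hA ext.
apply: (@read_run_le R p siteB n [::] ks F) => //.
  by apply/allP => k kin; apply: cnt; rewrite mem_cat kin orbT.
move=> w' z sw'; rewrite cats0 => ext; rewrite /F ler_nat.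
by case: asboolP => // Cz; rewrite (hB _ _ sw' ext Cz).
Qed.

(** * Certificates: order-independent descriptions of a completed reading *)

(** Here [a j.+1] bounds the number of lefts at the site [top - j].  If that
    site shows more than [a j] rights among its first [a j + a j.+1 + 1] coins,
    then it shows at most [a j.+1] lefts there; so, going down from [top], the
    exploration never needs more coins than the certificate allots.
    The inequalities, in place of the equalities that hold for the exploration
    itself, make the property monotone and thus usable for both orders. *)
Definition certificate (top : int) (J n : nat) (zeta : stacks) : Prop :=
  exists a : nat -> nat,
    (forall j, (j < J)%N ->
       (a j < count id (take (a j + a j.+1).+1 (zeta (top - j%:Z)%R))) %N) /\
    (\sum_(j < J) (a j + a j.+1).+1 <= n)%N.

Definition rights (site : strategy) (w : seq bool) (k : int) : nat :=
  count id (stk site w k).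

Definition lefts (site : strategy) (w : seq bool) (k : int) : nat :=
  count negb (stk site w k).

Lemma size_stk (site : strategy) (w : seq bool) (k : int) :
  size (stk site w k) = (rights site w k + lefts site w k)%N.
Proof. by rewrite /rights /lefts -(count_predC id). Qed.

Lemma size_push (eta : stacks) (k i : int) (b : bool) :
  size (push eta k b i) = (size (eta i) + (i == k))%N.
Proof. by rewrite /push; case: eqP => _; rewrite ?size_rcons ?addn1 ?addn0. Qed.

Lemma count_push (a : pred bool) (eta : stacks) (k i : int) (b : bool) :
  count a (push eta k b i) = (count a (eta i) + (a b && (i == k)))%N.
Proof.
rewrite /push; case: eqP => _; rewrite ?andbT ?andbF ?addn0 //.
by rewrite -cats1 count_cat /= addn0.
Qed.

Lemma sum_window (top k : int) (J : nat) :
  (\sum_(j < J) ((top - j%:Z)%R == k) = ((k <= top) && (top < k + J%:Z))%R :> nat)%N.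
Proof.
case: (boolP ((k <= top) && (top < k + J%:Z))) => [|h]; last first.
  rewrite big1 // => j _; case: eqP => // e; exfalso; move: h (ltn_ord j); lia.
move=> /andP[h1 h2].
have jJ : (`|(top - k)%R| < J)%N by lia.
rewrite (bigD1 (Ordinal jJ)) //= big1 => [|j /eqP nj].
  by have -> : top - `|(top - k)%R|%N%:Z == k by lia.
case: eqP => // e; exfalso; apply: nj; apply: val_inj => /=; lia.
Qed.

Lemma sum_size_stk (site : strategy) (w : seq bool) (top : int) (J : nat) :
  (\sum_(j < J) size (stk site w (top - j%:Z)%R) <= size w)%N.
Proof.
elim: w => [|b w IH]; first by rewrite big1.
under eq_bigr => j _ do rewrite /= size_push.
rewrite big_split /= sum_window -addn1; apply: leq_add => //; exact: leq_b1.
Qed.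

Fixpoint always (Q : seq bool -> bool) (w : seq bool) : bool :=
  Q w && (if w is _ :: w' then always Q w' else true).

Lemma always_now (Q : seq bool -> bool) (w : seq bool) : always Q w -> Q w.
Proof. by case: w => [|b w] /= /andP[]. Qed.

Lemma always_impl (Q Q' : seq bool -> bool) (w : seq bool) :
  (forall u, Q u -> Q' u) -> always Q w -> always Q' w.
Proof.
move=> h; elim: w => [|b w IH] /= /andP[q r]; first by rewrite h.
by rewrite h // IH.
Qed.

(** The actual numbers of lefts form the certificate: the length allotted to
    a site is then the exact number of coins read there. *)
Lemma completed_certificate (site : strategy) (w : seq bool) (top : int)
    (J : nat) (zeta : stacks) :
  (forall j, (j < J)%N ->
     rights site w (top - j%:Z)%R = (lefts site w (top - j%:Z + 1)%R).+1) ->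
  extends (stk site w) zeta -> certificate top J (size w) zeta.
Proof.
move=> h ext; exists (fun j : nat => lefts site w (top - j%:Z + 1)%R).
have len j : (j < J)%N -> (lefts site w (top - j%:Z + 1)%R
     + lefts site w (top - j.+1%:Z + 1)%R).+1 = size (stk site w (top - j%:Z)%R).
  move=> jJ; rewrite size_stk h // addSn; congr (_ + lefts _ _ _).+1; lia.
split=> [j jJ|].
  by rewrite len // (eqP (etrans (esym (prefixE _ _)) (ext _))) -/(rights _ _ _) h.
apply: leq_trans (sum_size_stk site w top J).
by apply: leq_sum => j _; rewrite len.
Qed.

(** The last condition says that the site about to be read has not received enough
    lefts from its right neighbour to have finished its part of a certificate. *)
Definition underfed (site : strategy) (top : int) (J : nat) (w : seq bool) : bool :=
  [&& site w <= top, top < site w + J%:Z &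
      (rights site w (site w) <= lefts site w (site w + 1)%R)%N].

(** Along such a run no site exhausts the length that a certificate allots to
    it: when it is read, its rights are bounded by the lefts of its right
    neighbour, hence by [a j], and its lefts by [a j.+1].  As one more coin is
    about to be read within the allotted lengths, their total exceeds
    the number of coins read so far. *)
Lemma underfed_no_certificate (site : strategy) (w : seq bool) (top : int)
    (J : nat) (zeta : stacks) :
  always (underfed site top J) w -> extends (stk site w) zeta ->
  ~ certificate top J (size w) zeta.
Proof.
move=> aw ext [a [ha suma]].
pose len j := (a j + a j.+1).+1.
(* [len j] coins show at least [a j + 1] rights, so at most [a j.+1] lefts *)
have few u j : (j < J)%N -> extends (stk site u) zeta ->
    (size (stk site u (top - j%:Z)%R) <= len j)%N ->
    (lefts site u (top - j%:Z)%R <= a j.+1)%N.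
  move=> jJ eu su; have := eu (top - j%:Z)%R; rewrite prefixE => /eqP eT.
  have pr : prefix (stk site u (top - j%:Z)%R) (take (len j) (zeta (top - j%:Z)%R)).
    by rewrite prefixE take_takel // eT.
  move: pr => /prefixP[t et].
  have := ha _ jJ; rewrite -/(len j) et.
  have := count_predC id (take (len j) (zeta (top - j%:Z)%R)).
  have : (size (take (len j) (zeta (top - j%:Z)%R)) <= len j)%N by rewrite
    size_take_min geq_minl.
  rewrite et !count_cat size_cat /lefts /len => h1 h2 h3.
  have -> : count negb (stk site u (top - j%:Z)%R) = count (predC id) (stk site u (top
    - j%:Z)%R) by [].
  lia.
have main u : always (underfed site top J) u -> extends (stk site u) zeta ->
    (forall j, (j < J)%N -> (size (stk site u (top - j%:Z)%R)
        + ((top - j%:Z)%R == site u) <= len j)%N) /\ stk site u (top + 1) = [::].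
  elim: u => [|b u IH] au eu.
    split=> // j jJ; by case: eqP.
  have eu' : extends (stk site u) zeta by apply: extends_push eu.
  move: (au) => /= /andP[bu au']; have [hs ht] := IH au' eu'.
  have top0 : stk site (b :: u) (top + 1) = [::].
    rewrite /= /push ht; case: eqP => // e.
    by move: (always_now au') => /and3P[]; rewrite -e; lia.
  have sz j : (j < J)%N -> (size (stk site (b :: u) (top - j%:Z)%R) <= len j)%N.
    by move=> jJ; rewrite /= size_push; apply: hs.
  split=> // j jJ.
  case: eqP => [e|_]; last by rewrite addn0; apply: sz.
  have /and3P[_ _ hU] := always_now au.
  rewrite addn1 -[push _ _ _]/(stk site (b :: u)) size_stk ltnS; apply: leq_add;
    last exact: few (sz _ jJ).
  rewrite e; apply: (leq_trans hU); rewrite -e.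
  case: j jJ e => [|j] jJ e; first by rewrite subr0 /lefts top0.
  have -> : top - j.+1%:Z + 1 = top - j%:Z by lia.
  by apply: few (sz _ (ltnW jJ)) => //; apply: ltnW.
have [hs _] := main w aw ext.
have szw : \sum_(j < J) size (stk site w (top - j%:Z)%R) = size w.
  elim: w aw {ext suma hs} => [|b u IH] /= /andP[_ au]; first by rewrite big1.
  under eq_bigr => j _ do rewrite size_push.
  rewrite big_split /= IH // sum_window; have /and3P[-> -> _] := always_now au.
  exact: addn1.
have : (\sum_(j < J) (size (stk site w (top - j%:Z)%R) + ((top - j%:Z)%R == site w))
        <= \sum_(j < J) len j)%N by apply: leq_sum => j _; apply: hs.
rewrite big_split /= szw sum_window; have /and3P[-> -> _] := always_now aw.
rewrite (_ : _ + _ = (size w).+1)%N; last exact: addn1.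
by move=> h; have := leq_trans h suma; rewrite ltnn.
Qed.

(** * Comparison of the walk with the exploration *)

Fixpoint pos (w : seq bool) : int :=
  if w is b :: w' then pos w' + (if b then 1 else -1) else 0.

(** The edge from [k] to [k + 1] is crossed alternately in the two directions. *)
Lemma crossing_balance (w : seq bool) (k : int) :
  (rights pos w k)%:Z - (lefts pos w (k + 1))%:Z
  = ((0 <= k) && (k < pos w))%:Z - ((pos w <= k) && (k < 0))%:Z.
Proof.
elim: w => [|b w IH]; first by rewrite /rights /lefts /=; lia.
rewrite /rights /lefts /= !count_push -/(rights pos w k) -/(lefts pos w (k + 1)).
move: IH; case: b => /=; lia.
Qed.

Fixpoint explored (w : seq bool) : xstate :=
  if w is b :: w' then xnext (explored w') b else (0%N, 0%N, 0%N).

Definition xsite (top : int) (w : seq bool) : int := top - (sites (explored w))%:Z.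

(** The last clause, that the sites below the current one are untouched, is what
    lets the exploration enter each of them with a cookie. *)
Lemma explored_stacks (top : int) (w : seq bool) :
  let: (s, j, v) := explored w in
  [/\ lefts (xsite top) w (top - s%:Z) = v,
      (j + rights (xsite top) w (top - s%:Z)%R)%N = lefts (xsite top) w (top - s%:Z + 1),
      forall i, (i < s)%N -> rights (xsite top) w (top - i%:Z)
                             = (lefts (xsite top) w (top - i%:Z + 1)).+1 &
      forall k, k < top - s%:Z -> stk (xsite top) w k = [::]].
Proof.
elim: w => [|b w] //=.
have xs : xsite top w = top - (sites (explored w))%:Z by [].
case: (explored w) xs => [[s j] v] xs [hl hr hc he].
rewrite /sites /= in xs.
have push0 k : (push (stk (xsite top) w) (xsite top w) b k = [::]) <->
    (k != top - s%:Z) /\ stk (xsite top) w k = [::].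
  rewrite /push xs; case: eqP => [->|_]; split=> //; last by case.
    by move=> /eqP; rewrite -size_eq0 size_rcons.
  by case.
have step : forall a k, count a (stk (xsite top) (b :: w) k)
    = (count a (stk (xsite top) w k) + (a b && (k == top - s%:Z)%R))%N.
  by move=> a k; rewrite /= count_push xs.
case: b step push0 => step push0 /=.
  case: j hr => [|j] hr.
    have e1 : stk (xsite top) w (top - s.+1%:Z) = [::] by apply: he; lia.
    have e2 : top - s.+1%:Z + 1 = top - s%:Z by lia.
    rewrite /lefts /rights e2; split.
    - rewrite step e1 /=; lia.
    - rewrite !step e1 /= -/(lefts _ _ _) hl; lia.
    - move=> i; rewrite ltnS leq_eqVlt !step /= => /orP[/eqP ->|i_s].
        by rewrite eqxx -/(rights _ _ _) -/(lefts _ _ _); lia.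
      by have := hc i i_s; rewrite /rights /lefts; lia.
    - move=> k hk; apply/push0; split; [lia|apply: he; lia].
  rewrite /lefts /rights; split.
  - by rewrite step /= addn0.
  - by rewrite !step /= eqxx -/(rights _ _ _) -/(lefts _ _ _); lia.
  - by move=> i i_s; rewrite !step /=; have := hc i i_s; rewrite /rights /lefts; lia.
  - move=> k hk; apply/push0; split; [lia|exact: he].
rewrite /lefts /rights; split.
- by rewrite step /= eqxx -/(lefts _ _ _) hl addn1.
- by rewrite !step /= -/(rights _ _ _) -/(lefts _ _ _); lia.
- by move=> i i_s; rewrite !step /=; have := hc i i_s; rewrite /rights /lefts; lia.
- move=> k hk; apply/push0; split; [lia|exact: he].
Qed.

Lemma sites_step (st : xstate) (b : bool) : (sites st <= sites (xnext st b))%N.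
Proof. by case: st => [[s [|j]] v]; case: b. Qed.

Lemma exploring_underfed (top : int) (J : nat) (w : seq bool) :
  (sites (explored w) < J)%N -> always (underfed (xsite top) top J) w.
Proof.
have now u : (sites (explored u) < J)%N -> underfed (xsite top) top J u.
  have := explored_stacks top u; rewrite /underfed /xsite /sites.
  case: (explored u) => [[s j] v] /= [_ hr _ _] sJ; rewrite -hr leq_addl andbT.
  by apply/andP; split; lia.
elim: w => [|b w IH] /= hJ; first by rewrite now.
rewrite (now (b :: w)) //= IH //; apply: leq_ltn_trans hJ; exact: sites_step.
Qed.

Lemma false_in_count (s : seq bool) : (false \in s) = (0 < count negb s)%N.
Proof. by rewrite -has_count; elim: s => //= b s IH; rewrite inE IH; case: b. Qed.

Lemma expect_explored (R : realFieldType) (p : R) (top : int) (n : nat) (H : xstate -> R) :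
  expect (run_prob p (xsite top)) wnext n [::] (H \o explored)
  = expect (xprob p) xnext n (0%N, 0%N, 0%N) H.
Proof.
apply: (@expect_sim _ _ _ _ _ _ _ explored) => // w.
have := explored_stacks top w.
rewrite /run_prob /xprob /coin /xsite /sites false_in_count.
case: (explored w) => [[s j] v] /= [hl _ _ _].
by rewrite -/(lefts _ _ _) hl lt0n; case: eqP.
Qed.

(** At a position at least [N] the balance of crossings is a certificate for
    the sites of [0, N). *)
Lemma walk_right_of (R : realFieldType) (p : R) (N n : nat) :
  2^-1 <= p -> p <= 1 ->
  expect (run_prob p pos) wnext n [::] (fun w => (N%:Z <= pos w)%R%:R)
  <= reach_prob p N n (0%N, 0%N, 0%N).
Proof.
move=> p2 p1; rewrite /reach_prob -(expect_explored p (N%:Z - 1)).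
apply: (@strategy_comparison R p pos (xsite (N%:Z - 1)) n
   (certificate (N%:Z - 1) N n)) => // w z sw.
  move=> hw ext; rewrite -sw; apply: completed_certificate ext => j jN.
  by have := crossing_balance w (N%:Z - 1 - j%:Z); lia.
move=> ext cert; rewrite leqNgt; apply/negP => /(exploring_underfed (N%:Z - 1)) u.
by apply: (underfed_no_certificate u ext); rewrite sw.
Qed.

(** A walk that stays in [-h, N) is always underfed.  The
    exploration asks for one right too many at each of the [h] negative sites,
    which is harmless since [h] is taken small compared with [n]. *)
Lemma walk_confined (R : realFieldType) (p : R) (h N n : nat) :
  2^-1 <= p -> p <= 1 ->
  expect (run_prob p pos) wnext n [::]
     (fun w => (always (fun u => (- h%:Z <= pos u) && (pos u < N%:Z))%R w)%:R)
  <= expect (xprob p) xnext n (0%N, 0%N, 0%N) (fun t => (sites t < N + h)%N%:R).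
Proof.
move=> p2 p1; rewrite -(expect_explored p (N%:Z - 1)).
apply: (@strategy_comparison R p pos (xsite (N%:Z - 1)) n
   (fun z => ~ certificate (N%:Z - 1) (N + h) n z)) => // w z sw.
  move=> aw ext; rewrite -sw; apply: underfed_no_certificate ext.
  apply: always_impl aw => u /andP[h1 h2]; rewrite /underfed.
  by have := crossing_balance u (pos u); lia.
move=> ext ncert; rewrite ltnNge; apply/negP => hs; apply: ncert.
rewrite -sw; apply: completed_certificate ext => j jJ.
have := explored_stacks (N%:Z - 1) w; move: hs; rewrite /sites.
case: (explored w) => [[s i] v] /= hs [_ _ hc _].
by apply: hc; apply: leq_trans hs.
Qed.

(** * The compensated walk *)

(** The ratio of the mean displacement to the mean number of cookies eaten when
    stepping from a site that has its cookie. *)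
Definition compensation (R : realFieldType) (p : R) : R := (2 * p - 1) / (1 - p).

Fixpoint displacement (D : int -> bool) (w : seq bool) : int :=
  if w is b :: w' then
    displacement D w' + (if D (pos w') then (if b then 1 else -1) else 0)
  else 0.

Definition eats (w : seq bool) (b : bool) : bool :=
  ~~ b && (false \notin stk pos w (pos w)).

Fixpoint meals (D : int -> bool) (w : seq bool) : nat :=
  if w is b :: w' then (meals D w' + (D (pos w') && eats w' b))%N else 0%N.

Definition walk_martingale (R : realFieldType) (p : R) (D : int -> bool)
    (w : seq bool) : R :=
  (displacement D w)%:~R - compensation p * (meals D w)%:R.

Lemma walk_martingale_step (R : realFieldType) (p : R) (D : int -> bool) (w : seq bool) :
  3 / 4 <= p -> p < 1 ->
  run_prob p pos w * walk_martingale p D (true :: w) ^+ 2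
  + (1 - run_prob p pos w) * walk_martingale p D (false :: w) ^+ 2
  <= walk_martingale p D w ^+ 2 + (1 + compensation p) ^+ 2.
Proof.
move=> p34 p1.
have q0 : 1 - p != 0 by rewrite gt_eqF //; lra.
have cq : compensation p * (1 - p) = 2 * p - 1 by rewrite /compensation mulfVK.
have c0 : 0 <= compensation p by rewrite divr_ge0; lra.
move: cq c0; set c := compensation p => cq c0.
pose r := run_prob p pos w; rewrite -/r.
have /andP[r2 r1] : 2^-1 <= r <= 1.
  by rewrite /r /run_prob /coin; case: ifP => _; apply/andP; split; lra.
set M := walk_martingale p D w.
pose x : R := walk_martingale p D (true :: w) - M.
pose y : R := walk_martingale p D (false :: w) - M.
have hy : y ^+ 2 <= (1 + c) ^+ 2 /\ r * x + (1 - r) * y = 0.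
  rewrite /y /x /M /walk_martingale /= -/c /r /run_prob /coin /eats.
  case: (D (pos w)); case: (false \in _) => /=;
    rewrite ?addn0 ?addr0 ?subrr ?mulr0 ?expr0n ?intrD ?natrD; split => //=; nra.
have [hy1 hy2] := hy.
have := centered_coin_var r2 r1 hy2.
have -> : walk_martingale p D (true :: w) = M + x by rewrite /x; ring.
have -> : walk_martingale p D (false :: w) = M + y by rewrite /y; ring.
move=> h.
have -> : r * (M + x) ^+ 2 + (1 - r) * (M + y) ^+ 2
  = M ^+ 2 + 2 * M * (r * x + (1 - r) * y) + (r * x ^+ 2 + (1 - r) * y ^+ 2) by ring.
by rewrite hy2 mulr0 addr0 lerD2l (le_trans h).
Qed.

Lemma run_prob01 (R : realFieldType) (p : R) (site : strategy) (w : seq bool) :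
  2^-1 <= p -> p <= 1 -> 0 <= run_prob p site w <= 1.
Proof. exact: coin01. Qed.

(** Kolmogorov's inequality: the induction on [n] is run from any word whose proper
    past has not crossed the level [m], and a word that is itself beyond the level
    makes the bound larger than one. *)
Lemma walk_martingale_maximal (R : realFieldType) (p : R) (D : int -> bool)
    (m : R) (n : nat) :
  3 / 4 <= p -> p < 1 -> 0 < m ->
  expect (run_prob p pos) wnext n [::]
    (fun w => (~~ always (fun u => `|walk_martingale p D u| < m)%R w)%:R)
  <= (1 + compensation p) ^+ 2 * n%:R / m ^+ 2.
Proof.
move=> p34 p1 m0; have m2 : 0 < m ^+ 2 by rewrite exprn_gt0.
have rp w : 0 <= run_prob p pos w <= 1 by apply: run_prob01; lra.
pose good : seq bool -> bool := fun u => `|walk_martingale p D u| < m.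
rewrite -/good; set c2 := (1 + compensation p) ^+ 2.
have c20 : 0 <= c2 by exact: sqr_ge0.
suff H w : always good (behead w) ->
    expect (run_prob p pos) wnext n w (fun w => (~~ always good w)%:R)
    <= (walk_martingale p D w ^+ 2 + c2 * n%:R) / m ^+ 2.
  have := H [::]; rewrite [walk_martingale _ _ _](_ : _ = 0); last first.
    by rewrite /walk_martingale /= mulr0 subrr.
  by rewrite expr0n add0r; apply;
    rewrite /= /good /walk_martingale /= mulr0 subrr normr0 m0.
elim: n w => [|n IH] w gw.
  case: (ltrP (`|walk_martingale p D w|) m) => [lt|ge].
    have -> : expect (run_prob p pos) wnext 0 w (fun w => (~~ always good w)%:R) = 0 :> R.
      rewrite /= (_ : always good w) //; case: w gw lt => [|b w] /= gw lt.
        by rewrite /good lt.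
      by rewrite gw andbT.
    by apply: divr_ge0; [rewrite addr_ge0 ?sqr_ge0 // mulr_ge0|exact: ltW].
  apply: (@le_trans _ _ 1); first by rewrite /= lern1 leq_b1.
  rewrite ler_pdivlMr // mul1r mulr0 addr0 -[leRHS]real_normK ?num_real //.
  by rewrite ler_pXn2r ?nnegrE ?(ltW m0).
case: (ltrP (`|walk_martingale p D w|) m) => [lt|ge]; last first.
  apply: (@le_trans _ _ 1).
    rewrite -[leRHS](expect_cst (run_prob p pos) wnext 1 n.+1 w).
    by apply: expect_mono => // u; rewrite lern1 leq_b1.
  rewrite ler_pdivlMr // mul1r; apply: (@le_trans _ _ (walk_martingale p D w ^+ 2)).
    rewrite -[leRHS]real_normK ?num_real //.
    by rewrite ler_pXn2r ?nnegrE ?(ltW m0).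
  by rewrite lerDl mulr_ge0.
have aw : always good w.
  by case: w gw lt => [|b w] /= gw lt; [rewrite /good lt|rewrite gw andbT].
have /andP[r0 r1] := rp w.
rewrite [expect _ _ _ _ _]/=.
have hT := IH (true :: w) aw; have hF := IH (false :: w) aw.
have st := walk_martingale_step D w p34 p1; rewrite -/c2 in st.
apply: (@le_trans _ _ (run_prob p pos w * ((walk_martingale p D (true :: w) ^+ 2 + c2 *
  n%:R) / m ^+ 2)
  + (1 - run_prob p pos w) * ((walk_martingale p D (false :: w) ^+ 2 + c2 * n%:R) / m
    ^+ 2))).
  by apply: lerD; apply: ler_wpM2l => //; rewrite subr_ge0.
rewrite !mulrA -mulrDl ler_pM2r ?invr_gt0 // -[n.+1%:R]natr1.
move: st; move: (walk_martingale p D (true :: w)) (walk_martingale p D (false :: w)) => X Y.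
lra.
Qed.

Lemma displacement_all (w : seq bool) : displacement xpredT w = pos w.
Proof. by elim: w => //= b w ->. Qed.

(** Steps from the right of [y] change [max (pos, y)] by the same amount; the only
    other steps that change it are those from [y] to [y + 1], which increase it. *)
Lemma displacement_right (y : int) (w : seq bool) :
  0 <= y -> displacement (fun k => y < k) w + y <= Num.max (pos w) y.
Proof.
move=> y0; elim: w => [|b w] /=; first by lia.
by case: (ltrP y (pos w)) => h; case: b; lia.
Qed.

(** A cookie missing in the end was eaten at some point; the sites of (y, N]
    are listed from [N] downwards. *)
Lemma meals_lower (y N : nat) (w : seq bool) : (y <= N)%N ->
  (\sum_(j < N - y) (false \in stk pos w (N%:Z - j%:Z)%R)
     <= meals (fun k => (y%:Z < k)%R) w)%N.
Proof.
move=> yN; elim: w => [|b w IH]; first by rewrite big1.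
apply: (@leq_trans (\sum_(j < N - y) (false \in stk pos w (N%:Z - j%:Z)%R)
   + \sum_(j < N - y) ((N%:Z - j%:Z)%R == pos w) * eats w b)%N).
  rewrite -big_split /=; apply: leq_sum => j _; rewrite /push /eats.
  case: eqP => [->|_]; last by rewrite leq_addr.
  by rewrite mem_rcons inE; case: b; case: (false \in _).
rewrite /=; apply: leq_add => //; rewrite -big_distrl /= sum_window.
rewrite mulnb; case: (eats w b); rewrite ?andbF // !andbT.
by case: andP => // -[h1 h2]; rewrite lt0b; lia.
Qed.

Lemma visited_right (N : int) (w : seq bool) (k : int) :
  ~~ always (fun u => pos u < N) w -> 0 <= k -> k < N -> (0 < rights pos w k)%N.
Proof.
elim: w => [|b w IH] /= h k0 kN.
  by move: h; rewrite andbT; lia.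
move: h; rewrite negb_and => /orP[h|h].
  by have := crossing_balance (b :: w) k; rewrite /=; lia.
have := IH h k0 kN; rewrite /rights /= count_push; lia.
Qed.

(** A walk that has been at [N] and is back at [y] or below has stepped left from,
    and hence eaten the cookie of, every site of (y, N]. *)
Lemma backtrack_martingale (R : realFieldType) (p : R) (y N : nat) (w : seq bool) :
  2^-1 <= p -> p < 1 -> (y <= N)%N -> pos w <= y%:Z ->
  ~~ always (fun u => pos u < N%:Z) w ->
  walk_martingale p (fun k => y%:Z < k) w <= - (compensation p * (N - y)%:R).
Proof.
move=> p2 p1 yN wy hN.
have c0 : 0 <= compensation p by rewrite divr_ge0; lra.
have hd := @displacement_right y%:Z w isT.
have d0 : (displacement (fun k => y%:Z < k) w)%:~R <= 0 :> R by rewrite lerz0; lia.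
have m0 : (N - y <= meals (fun k => (y%:Z < k)%R) w)%N.
  apply: leq_trans (meals_lower w yN).
  rewrite -[X in (X <= _)%N]card_ord -sum1_card; apply: leq_sum => j _.
  rewrite lt0b false_in_count -/(lefts pos w _).
  have jl := ltn_ord j.
  have := @visited_right N%:Z w (N%:Z - j%:Z - 1) hN.
  have := crossing_balance w (N%:Z - j%:Z - 1).
  have -> : N%:Z - j%:Z - 1 + 1 = N%:Z - j%:Z by lia.
  lia.
rewrite /walk_martingale -[leRHS]add0r; apply: lerD => //.
by rewrite lerN2 ler_wpM2l // ler_nat.
Qed.

(** Cookies eaten only lower the martingale below the position. *)
Lemma walk_left_of_origin (R : realFieldType) (p : R) (k n : nat) :
  3 / 4 <= p -> p < 1 -> (0 < k)%N ->
  expect (run_prob p pos) wnext n [::] (fun w => (pos w <= - k%:Z)%R%:R)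
  <= (1 + compensation p) ^+ 2 * n%:R / k%:R ^+ 2.
Proof.
move=> p34 p1 k0.
have c0 : 0 <= compensation p by rewrite divr_ge0; lra.
have kR : 0 < k%:R :> R by rewrite ltr0n.
apply: le_trans (walk_martingale_maximal xpredT n p34 p1 kR).
apply: expect_mono => [w|w]; first by apply: run_prob01; lra.
rewrite ler_nat; case: (lerP (pos w)) => // wk.
suff -> : always (fun u => `|walk_martingale p xpredT u| < k%:R) w = false by [].
apply/negP => /always_now; apply/negP; rewrite -leNgt ler_normr; apply/orP; right.
rewrite /walk_martingale displacement_all opprB lerBrDl.
have : (pos w)%:~R <= - k%:R :> R by rewrite -[k%:R]/(k%:Z%:~R) -mulrNz ler_int.
have : 0 <= compensation p * (meals xpredT w)%:R by rewrite mulr_ge0.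
lra.
Qed.

(** A walk that ends at or below [y] has stayed in [-k, y + 2 k), or has
    been to the left of [-k], or has backtracked from [y + 2 k]; the
    martingale inequality excludes the last two. *)
Lemma walk_left_of (R : realFieldType) (p : R) (y k n : nat) :
  3 / 4 <= p -> p < 1 -> (0 < k)%N ->
  expect (run_prob p pos) wnext n [::] (fun w => (pos w <= y%:Z)%R%:R)
  <= expect (xprob p) xnext n (0%N, 0%N, 0%N) (fun t => (sites t < y + 3 * k)%N%:R)
     + 2 * ((1 + compensation p) ^+ 2 * n%:R / k%:R ^+ 2).
Proof.
move=> p34 p1 k0.
have c1 : 1 <= compensation p by rewrite ler_pdivlMr; lra.
have kR : 0 < k%:R :> R by rewrite ltr0n.
have conf := @walk_confined R p k (y + 2 * k) n.
have m1 := walk_martingale_maximal xpredT n p34 p1 kR.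
have m2 := walk_martingale_maximal (fun i => y%:Z < i) n p34 p1 kR.
have -> : (y + 3 * k = y + 2 * k + k)%N by lia.
rewrite mulr2n mulrDl mul1r addrA.
apply: le_trans (lerD (lerD (conf _ _) m1) m2); try lra.
rewrite -!expect_add; apply: expect_mono => [w|w]; first by apply: run_prob01; lra.
rewrite -!natrD ler_nat.
case: (lerP (pos w)) => // wy.
case: (boolP (always _ w)) => //= nconf.
case: (boolP (always _ w)) => //= g1.
case: (boolP (always _ w)) => //= g2.
exfalso; move: nconf => /negP; apply.
have lo : always (fun u => - k%:Z <= pos u) w.
  apply: always_impl g1 => u;
    rewrite /walk_martingale displacement_all ltr_norml => /andP[h _].
  have h2 : 0 <= compensation p * (meals xpredT u)%:R by rewrite mulr_ge0 //; lra.
  have : - k%:R < (pos u)%:~R :> R by lra.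
  by rewrite -[k%:R]/(k%:Z%:~R) -mulrNz ltr_int; apply: ltW.
have hi : always (fun u => pos u < (y + 2 * k)%N%:Z) w.
  apply/negPn/negP => nhi.
  have := backtrack_martingale (le_trans _ p34) p1 (leq_addr _ _) wy nhi.
  have := always_now g2; rewrite ltr_norml => /andP[h _].
  rewrite addKn natrM => h2.
  have : k%:R <= compensation p * (2 * k%:R).
    have : k%:R <= compensation p * k%:R by rewrite ler_peMl.
    by rewrite mulrCA; lra.
  have := h2 _; lra.
by elim: w lo hi {wy g1 g2} => [|b w IH] /= /andP[-> ?] /andP[-> ?] //=; apply: IH.
Qed.

(** * From coin words to the given probability space *)

(** The latest coin comes first in [w], so past positions belong to suffixes. *)
Definition trajectory (w : seq bool) (i : nat) : int := pos (drop (size w - i) w).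

Lemma trajectory_size (w : seq bool) : trajectory w (size w) = pos w.
Proof. by rewrite /trajectory subnn drop0. Qed.

Lemma trajectory_cons (b : bool) (w : seq bool) (i : nat) :
  (i <= size w)%N -> trajectory (b :: w) i = trajectory w i.
Proof. by move=> h; rewrite /trajectory /= subSn. Qed.

Lemma stk_has_left (w : seq bool) (k : int) :
  reflect (exists i, [/\ (i < size w)%N, trajectory w i = k & trajectory w i.+1 = k - 1])
          (false \in stk pos w k).
Proof.
elim: w => [|b w IH]; first by rewrite /= in_nil; apply: ReflectF => -[i []].
apply: (iffP idP).
  rewrite /= /push; case: eqP => [kw|_]; last first.
    move=> /IH[i [h1 h2 h3]]; exists i.
    by rewrite !trajectory_cons ?(ltnW h1) //; split => //; apply: ltnW.
  rewrite mem_rcons inE => /orP[/eqP bF|/IH[i [h1 h2 h3]]]; last first.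
    by exists i; rewrite !trajectory_cons ?(ltnW h1) //; split => //; apply: ltnW.
  exists (size w); rewrite trajectory_cons // trajectory_size (trajectory_size (b :: w));
    split=> //=.
  rewrite kw.
  by rewrite -bF.
move=> [i [h1 h2 h3]]; rewrite /= /push.
move: h1; rewrite /= ltnS leq_eqVlt => /orP[/eqP iw|iw]; last first.
  have h : false \in stk pos w k.
    by apply/IH; exists i; move: h2 h3; rewrite !trajectory_cons ?(ltnW iw).
  by case: eqP => _ //; rewrite mem_rcons inE h orbT.
subst i; move: h2 h3;
  rewrite trajectory_cons // trajectory_size (trajectory_size (b :: w)) /= => <-.
by rewrite eqxx mem_rcons inE; case: b => // h; exfalso; lia.
Qed.

Lemma cookie_eaten_trajectory (w : seq bool) (k : int) :
  cookie_eaten (trajectory w) (size w) k = (false \in stk pos w k).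
Proof.
apply/idP/idP => [/existsP[i /andP[/eqP h1 /eqP h2]]|/stk_has_left[i [h0 h1 h2]]].
  by apply/stk_has_left; exists (val i); split => //; exact: (ltn_ord i).
by apply/existsP; exists (Ordinal h0) => /=; rewrite h1 h2 !eqxx.
Qed.

Lemma right_prob_trajectory (R : realType) (p : R) (w : seq bool) :
  right_prob p (trajectory w) (size w) = run_prob p pos w.
Proof. by rewrite /right_prob cookie_eaten_trajectory trajectory_size. Qed.

Definition follows (T : Type) (X : nat -> T -> int) (w : seq bool) : set T :=
  history X (trajectory w) (size w).

Lemma follows_cons (T : Type) (X : nat -> T -> int) (w : seq bool) (b : bool) :
  follows X (b :: w) = follows X w `&`
    [set t | X (size w).+1 t = pos w + (if b then 1 else -1)].
Proof.
apply/seteqP; split => [t h|t [h1 h2] i] /=.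
  split=> [i iw|].
    by rewrite -(trajectory_cons b) //; apply: h; rewrite /= leqW.
  by rewrite (h (size w).+1 (leqnn _)) (trajectory_size (b :: w)).
rewrite leq_eqVlt => /orP[/eqP ->|]; first by rewrite (trajectory_size (b :: w)).
by rewrite ltnS => iw; rewrite trajectory_cons //; apply: h1.
Qed.

Section transfer.
Context (R : realType) (d : measure_display) (T : measurableType d).
Context (P : probability T R) (p : R) (X : nat -> T -> int).
Context (HX : is_HYC_walk P p X).

Lemma prob_union (A B : set T) : measurable A -> measurable B ->
  (P (A `|` B) <= P A + P B)%E.
Proof. by move=> mA mB; exact: measureU2. Qed.

Lemma measurable_event (n : nat) (Q : int -> Prop) : measurable [set t | Q (X n t)].
Proof.
have -> : [set t | Q (X n t)] =
    \bigcup_(k : int) [set t | X n t = k /\ Q k].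
  apply/seteqP; split => [t h|t [k _ [<-]]] //.
  by exists (X n t).
apply: countable_bigcupT_measurable => [|k]; first exact: countableP.
have [Qk|nQk] := pselect (Q k).
  rewrite (_ : [set t | _] = [set t | X n t = k]); first exact: (HYC_measurable HX).
  by apply/seteqP; split => t // [].
rewrite (_ : [set t | _] = set0); first exact: measurable0.
by apply/seteqP; split => t // [].
Qed.

Lemma measurable_follows (w : seq bool) : measurable (follows X w).
Proof.
elim: w => [|b w IH].
  have -> : follows X [::] = [set t | X 0%N t = 0].
    apply/seteqP; split => [t h|t h i] /=; first exact: h 0%N isT.
    by rewrite leqn0 => /eqP ->; rewrite h.
  exact: (measurable_event 0 (fun k => k = 0)).
rewrite follows_cons; apply: measurableI => //.
exact: (measurable_event _ (fun k => k = _)).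
Qed.

Lemma follows_step (w : seq bool) (b : bool) :
  P (follows X (b :: w)) =
  ((if b then run_prob p pos w else 1 - run_prob p pos w)%:E * P (follows X w))%E.
Proof.
rewrite follows_cons; case: b.
  by have := HYC_right HX (size w) (trajectory w);
    rewrite trajectory_size right_prob_trajectory.
by have := HYC_left HX (size w) (trajectory w);
  rewrite trajectory_size right_prob_trajectory.
Qed.

Definition strays (w : seq bool) : set T :=
  follows X w `\` (follows X (true :: w) `|` follows X (false :: w)).

Lemma strays_null (w : seq bool) : P (strays w) = 0%E.
Proof.
have mT := measurable_follows (true :: w); have mF := measurable_follows (false :: w).
have m0 := measurable_follows w.
have fin : P (follows X w) \is a fin_num by apply: fin_num_measure.
have total : (P (follows X (true :: w)) + P (follows X (false :: w)) = P (follows X w))%E.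
  rewrite !follows_step -muleDl ?fin_num_adde_defl //.
  by rewrite -EFinD addrC subrK mul1e.
rewrite /strays measureD //; [|exact: measurableU|by rewrite ltey_eq fin].
rewrite setIidr; last by move=> t []; rewrite follows_cons => -[].
rewrite measureU //; last first.
  rewrite !follows_cons; apply/seteqP; split => // t [[_ /= h1] [_ /= h2]].
  by move: h1 h2 => /= -> h; exfalso; lia.
rewrite [X in (_ - X)%E](_ : _ = P (follows X w)); first exact: subee.
exact: total.
Qed.

(** By induction on [n], conditioning on the next step; steps that are not to
    a neighbour have probability zero. *)
Lemma follows_event_le (w : seq bool) (n : nat) (Q : int -> bool) :
  2^-1 <= p -> p <= 1 ->
  (P (follows X w `&` [set t | Q (X (size w + n) t)])
   <= (expect (run_prob p pos) wnext n w (fun u => (Q (pos u))%:R))%:E * P (follows X w))%E.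
Proof.
move=> p2 p1.
have mQ m : measurable [set t | Q (X m t)] by exact: (measurable_event m Q).
elim: n w => [|n IH] w.
  rewrite addn0 /=; case: (boolP (Q (pos w))) => Qw.
    rewrite mul1e le_measure ?inE //;
      first exact: measurableI (measurable_follows w) (mQ _).
    exact: measurable_follows.
  rewrite mul0e (_ : _ `&` _ = set0) ?measure0 //.
  apply/seteqP; split => // t [h1 /= h2]; move: h2.
  by rewrite (h1 (size w) (leqnn _)) trajectory_size (negPf Qw).
pose E := [set t | Q (X (size w + n.+1) t)].
have mE : measurable E by exact: mQ.
have mT := measurable_follows (true :: w); have mF := measurable_follows (false :: w).
have m0 := measurable_follows w.
have mS : measurable (strays w) by apply: measurableD => //; exact: measurableU.
apply: (@le_trans _ _ (P ((follows X (true :: w) `&` E) `|` (follows X (false :: w) `&`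
  E) `|` strays w))).
  rewrite le_measure ?inE //.
  - exact: measurableI.
  - by apply: measurableU => //; apply: measurableU; apply: measurableI.
  move=> t [h1 h2]; have [[hT|hF]|h] := pselect ((follows X (true :: w) `|` follows X
    (false :: w)) t).
  - by left; left.
  - by left; right.
  - by right.
apply: le_trans (prob_union _ _) _ => //.
  by apply: measurableU; apply: measurableI.
rewrite strays_null adde0; apply: le_trans (prob_union _ _) _; try exact: measurableI.
have hT := IH (true :: w); have hF := IH (false :: w).
rewrite /= addSnnS in hT hF.
have /andP[r0 r1] := @run_prob01 _ p pos w p2 p1.
apply: le_trans (leeD hT hF) _.
rewrite -!/(follows X _) [P (follows X (true :: w))]follows_step
  [P (follows X (false :: w))]follows_step !muleA -!EFinM -muleDl ?fin_num_adde_defl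
    ?fin_num_measure //.
rewrite -EFinD; apply: lee_wpmul2r; first exact: measure_ge0.
by rewrite lee_fin /= mulrC [X in _ + X]mulrC.
Qed.

Lemma follows_nil : {ae P, forall t, follows X [::] t}.
Proof.
have := HYC_start HX; apply: filterS => t h i.
by rewrite leqn0 => /eqP ->.
Qed.

Lemma walk_event_le (n : nat) (Q : int -> bool) : 2^-1 <= p -> p <= 1 ->
  (P [set t | Q (X n t)]
   <= (expect (run_prob p pos) wnext n [::] (fun u => (Q (pos u))%:R))%:E)%E.
Proof.
move=> p2 p1.
have m0 := measurable_follows [::].
have mQ : measurable [set t | Q (X n t)] by exact: (measurable_event n Q).
have P0 : P (~` follows X [::]) = 0%E.
  apply/negligibleP; first exact: measurableC.
  exact: follows_nil.
have P1 : P (follows X [::]) = 1%E.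
  by have := probability_setC P m0; rewrite P0 => /eqP;
    rewrite eq_sym sube_eq ?fin_num_measure // ?add0e => /eqP.
apply: (@le_trans _ _ (P ((follows X [::] `&` [set t | Q (X n t)]) `|` ~` follows X [::]))).
  rewrite le_measure ?inE //.
    by apply: measurableU; [exact: measurableI|exact: measurableC].
  by move=> t h; have [h0|h0] := pselect (follows X [::] t); [left|right].
apply: le_trans (prob_union _ _) _; [exact: measurableI|exact: measurableC|].
rewrite P0 adde0; apply: le_trans (follows_event_le [::] n Q p2 p1) _.
by rewrite P1 mule1.
Qed.

(** There are only countably many words, so almost surely the walk never
    strays. *)
Lemma ae_follows : {ae P, forall t, forall n, exists2 w, size w = n & follows X w t}.
Proof.
have h : {ae P, forall t, forall w, ~ strays w t}.
  pose F (n : nat) : set T := if unpickle n is Some w then strays w else set0.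
  apply: (@negligibleS _ _ _ _ (\bigcup_n F n)).
    move=> t /= /existsNP[w /contrapT hw]; exists (pickle w) => //.
    by rewrite /F pickleK.
  apply: negligible_bigcup => n; rewrite /F; case: unpickle => [w|];
    last exact: negligible_set0.
  apply/negligibleP; last exact: strays_null.
  apply: measurableD; first exact: measurable_follows.
  by apply: measurableU; exact: measurable_follows.
have := follows_nil; move: h; apply: filterS2 => t ns f0; elim=> [|n [w sw fw]].
  by exists [::].
have := ns w; rewrite /strays => h;
  have [[hT|hF]|h'] := pselect ((follows X (true :: w) `|` follows X (false :: w)) t).
- by exists (true :: w); rewrite //= sw.
- by exists (false :: w); rewrite //= sw.
- by exfalso; apply: h.
Qed.

Lemma ae_nearest_neighbour :
  {ae P, forall t, forall n, `|X n.+1 t - X n t| <= 1}.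
Proof.
have := ae_follows; apply: filterS => t h n.
have [[|b w] //= [sw] fw] := h n.+1.
move: (fw); rewrite follows_cons => -[fw' /= e].
move: e (fw' (size w) (leqnn _)); rewrite trajectory_size sw => -> ->.
by case: b {fw h}; lia.
Qed.

(** The Borel-Cantelli lemma, with the convergence of the sum of the [1 / L ^ 2]
    obtained by comparison with a telescoping series. *)
Lemma eventually_avoids (C : R) (L0 : nat) (n_ : nat -> nat) (Q : nat -> int -> bool) :
  (forall L, (L0 <= L)%N -> (P [set t | Q L (X (n_ L) t)] <= (C / L%:R ^+ 2)%:E)%E) ->
  {ae P, forall t, exists L1, forall L, (L1 <= L)%N -> ~~ Q L (X (n_ L) t)}.
Proof.
move=> bnd.
pose F L := [set t | Q (L + L0).+1 (X (n_ (L + L0).+1) t)].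
have mF L : measurable (F L) by exact: (measurable_event _ (Q _)).
have C0 : 0 <= C.
  have := bnd L0.+1 (leqnSn _) => h; have := le_trans (measure_ge0 _ _) h.
  by rewrite lee_fin pmulr_lge0 // invr_gt0 exprn_gt0.
have sumF : (\sum_(n <oo) P (F n) < +oo)%E.
  apply: (@le_lt_trans _ _ (2 * C)%:E); last exact: ltry.
  apply: lime_le; first by apply: is_cvg_nneseries => n _ _; exact: measure_ge0.
  apply: nearW => n.
  apply: (@le_trans _ _ (2 * C * (1 - n.+1%:R^-1))%:E).
    elim: n => [|n IH]; first by rewrite big_geq // invr1 subrr mulr0.
    rewrite big_nat_recr //=; apply: (le_trans (leeD IH (bnd (n + L0).+1 _))); first by lia.
    rewrite -EFinD lee_fin.
    have h1 : C / (n + L0).+1%:R ^+ 2 <= C / n.+1%:R ^+ 2.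
      apply: ler_wpM2l => //; rewrite lef_pV2 ?posrE ?exprn_gt0 //.
      by rewrite ler_pXn2r ?nnegrE // ler_nat; lia.
    have h2 : n.+1%:R^-1 ^+ 2 <= 2 * (n.+1%:R^-1 - n.+2%:R^-1) :> R.
      have e : n.+1%:R^-1 - n.+2%:R^-1 = n.+1%:R^-1 * n.+2%:R^-1 :> R.
        have a : n.+1%:R != 0 :> R by rewrite pnatr_eq0.
        have b : n.+1%:R + 1 != 0 :> R by rewrite natr1 pnatr_eq0.
        rewrite -[n.+2%:R]natr1; move: (n.+1%:R : R) a b => x a b.
        by field; rewrite a b.
      rewrite e expr2 mulrCA; apply: ler_wpM2l; first by rewrite invr_ge0.
      rewrite -ler_pdivrMl // -invfM lef_pV2 ?posrE ?mulr_gt0 //.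
      by rewrite -natrM ler_nat; lia.
    move: h1 (ler_wpM2l C0 h2); rewrite -[(n.+1%:R ^+ 2)^-1]exprVn.
    move: (C / _) (n.+1%:R^-1 : R) (n.+2%:R^-1 : R) => z u v h1 h3; lra.
  rewrite lee_fin ler_piMr ?mulr_ge0 // gerBl invr_ge0 //.
have := lim_sup_set_cvg0 mF sumF.
move=> h0; exists (lim_sup_set F); split=> //.
  by apply: bigcap_measurable => // k _; apply: bigcup_measurable.
move=> t /= nh n _; apply: contrapT => hn; apply: nh.
exists (n + L0).+1 => L hL; apply/negP => QL; apply: hn.
exists (L.-1 - L0)%N; first by rewrite /=; lia.
by rewrite /F /= (_ : (L.-1 - L0 + L0).+1 = L) //; lia.
Qed.

End transfer.

(** * Concentration of the position of the walk *)

(** The concentration estimate needs a parameter above [3/4]: it is [p] itself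
    if possible, and otherwise a slightly larger one. *)
Lemma compare_speed (R : realFieldType) (p eps : R) :
  3 / 4 <= p -> p < 1 -> 0 < eps ->
  exists p' : R, [/\ p <= p', 3 / 4 < p', p' < 1, 4 * p' <= 4 * p + eps / 4
                   & 3 / 4 < p -> p' = p].
Proof.
move=> p34 p1 e0.
have [lt|ge] := ltP (3 / 4) p; first by exists p; split => //; lra.
have -> : p = 3 / 4 by lra.
exists (3 / 4 + Num.min eps 1 / 16).
have m0 : 0 < Num.min eps 1 by rewrite lt_min e0 ltr01.
have m1 : Num.min eps 1 <= 1 by rewrite ge_min lexx orbT.
have me : Num.min eps 1 <= eps by rewrite ge_min lexx.
by split; lra.
Qed.

(** Let [v = 4 p - 3].  Positions to the right of [(v + eps) n] are excluded by
    comparison with the exploration for the parameter [p'].  Positions to the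
    left of [(v - eps) n] are excluded by [walk_left_of_origin] if [v] is so
    small that they are far to the left of the origin, and by [walk_left_of]
    otherwise, in which case [p' = p]. *)
Lemma walk_concentration (R : archiRealFieldType) (p eps : R) :
  3 / 4 <= p -> p < 1 -> 0 < eps ->
  exists (M : nat) (C : R) (L0 : nat), (1 < M)%N /\
  forall L : nat, (L0 <= L)%N ->
  expect (run_prob p pos) wnext (L ^ M) [::]
    (fun w => (eps * (L ^ M)%:R <= `|(pos w)%:~R - (4 * p - 3) * (L ^ M)%:R|)%R%:R)
  <= C / L%:R ^+ 2.
Proof.
move=> p34 p1 e0.
have [p' [pp' p'34 p'1 p'e p'p]] := compare_speed p34 p1 e0.
have [M M1 conc] := explore_concentration p'34 p'1.
have e40 : 0 < eps / 4 by rewrite divr_gt0.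
have [C [L0 hC]] := conc _ e40.
set c2 : R := (1 + compensation p) ^+ 2.
exists M, (C + (C + 2 * (c2 * ((32 / eps) ^+ 2)))), (maxn L0 (Num.bound (32 / eps)).+1).
split=> // L; rewrite geq_max => /andP[LL0 LB].
have L1 : (0 < L)%N by apply: leq_trans LB.
have LR : 32 / eps <= L%:R.
  apply: ltW; apply: (@lt_le_trans _ _ (Num.bound (32 / eps))%:R).
    by apply: archi_boundP; rewrite divr_ge0 // ltW.
  by rewrite ler_nat; apply: leq_trans LB.
have [n nE] : exists n, n = (L ^ M)%N by eexists.
have hCn := hC L LL0; rewrite -nE in hCn *.
have nL2 : L%:R ^+ 2 <= n%:R :> R by rewrite -natrX ler_nat nE leq_pexp2l.
have L2R : 0 < L%:R ^+ 2 :> R by rewrite exprn_gt0 // ltr0n.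
have nL : L%:R <= n%:R :> R.
  apply: le_trans nL2; rewrite expr2 ler_peMr // ler1n //.
have n32 : 32 <= eps * n%:R.
  by have := le_trans LR nL; rewrite ler_pdivrMr // mulrC.
have n0 : 0 < n%:R :> R by apply: lt_le_trans nL2.
have c20 : 0 <= c2 by exact: sqr_ge0.
pose k := Num.truncn (eps * n%:R / 16).
have /andP[k1 k2] : k%:R <= eps * n%:R / 16 < k.+1%:R by apply: truncn_itv; lra.
have kR : eps * n%:R / 32 <= k%:R by move: k2; rewrite -[k.+1%:R]natr1; lra.
have k0 : (0 < k)%N by rewrite -(@ltr0n R); lra.
have tail : c2 * n%:R / k%:R ^+ 2 <= c2 * ((32 / eps) ^+ 2) / L%:R ^+ 2.
  rewrite -(mulrA c2 n%:R) -(mulrA c2 ((32 / eps) ^+ 2)).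
  apply: (ler_wpM2l c20).
  apply: (@le_trans _ _ (n%:R / (eps * n%:R / 32) ^+ 2)).
    apply: ler_wpM2l; first exact: ltW.
    rewrite lef_pV2 ?posrE ?exprn_gt0 ?ltr0n //; last by lra.
    by rewrite ler_pXn2r ?nnegrE //; lra.
  have -> : n%:R / (eps * n%:R / 32) ^+ 2 = (32 / eps) ^+ 2 * n%:R^-1.
    by field; rewrite !gt_eqF.
  apply: ler_wpM2l; first exact: sqr_ge0.
  by rewrite lef_pV2 ?posrE.
have up : expect (run_prob p pos) wnext n [::]
    (fun w => ((4 * p - 3 + eps) * n%:R <= (pos w)%:~R)%R%:R) <= C / L%:R ^+ 2.
  apply: le_trans hCn.
  pose N := Num.truncn ((4 * p - 3 + eps) * n%:R).
  have /andP[N1 N2] : N%:R <= (4 * p - 3 + eps) * n%:R < N.+1%:R.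
    by apply: truncn_itv; apply: mulr_ge0; lra.
  apply: (@le_trans _ _ (reach_prob p N n (0%N, 0%N, 0%N))).
    apply: le_trans (walk_right_of _ _ _ _); try lra.
    apply: expect_mono => [w|w]; first by apply: run_prob01; lra.
    rewrite ler_nat; case: (lerP (_ * n%:R)) => // h.
    by have -> : N%:Z <= pos w by rewrite -(ler_int R); apply: le_trans h.
  apply: (@le_trans _ _ (reach_prob p' N n (0%N, 0%N, 0%N))).
    by apply: reach_prob_mono; lra.
  apply: expect_mono => [t|t]; first by apply: xprob01; lra.
  rewrite ler_nat; case: (leqP N) => // h.
  suff -> : eps / 4 * n%:R <= `|(sites t)%:R - (4 * p' - 3) * n%:R| by [].
  rewrite ler_normr; apply/orP; left.
  have : N%:R <= (sites t)%:R :> R by rewrite ler_nat.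
  move: N2; rewrite -[N.+1%:R]natr1.
  have : 4 * p' * n%:R <= (4 * p + eps / 4) * n%:R by apply: ler_wpM2r => //; exact: ltW.
  lra.
have lo : expect (run_prob p pos) wnext n [::]
    (fun w => ((pos w)%:~R <= (4 * p - 3 - eps) * n%:R)%R%:R)
    <= C / L%:R ^+ 2 + 2 * (c2 * ((32 / eps) ^+ 2) / L%:R ^+ 2).
  have hC0 : 0 <= C / L%:R ^+ 2.
    apply: le_trans hCn; rewrite -(expect_cst (xprob p') xnext 0 n (0%N, 0%N, 0%N)).
    by apply: expect_mono => [t|t] //; apply: xprob01; lra.
  have t0 : 0 <= c2 * n%:R / k%:R ^+ 2 by rewrite divr_ge0 ?sqr_ge0 // mulr_ge0.
  have [small|big] := lerP (4 * p - 3) (eps / 2).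
    apply: (@le_trans _ _ (c2 * n%:R / k%:R ^+ 2)); last by lra.
    apply: le_trans (walk_left_of_origin n p34 p1 k0).
    apply: expect_mono => [w|w]; first by apply: run_prob01; lra.
    rewrite ler_nat; case: (lerP _ ((4 * p - 3 - eps) * n%:R)) => // h.
    have -> : pos w <= - k%:Z; last by [].
    rewrite -(ler_int R) mulrNz.
    have : (4 * p - 3) * n%:R <= eps / 2 * n%:R by apply: ler_wpM2r => //; exact: ltW.
    lra.
  have pE : p' = p by apply: p'p; lra.
  rewrite pE in hCn.
  pose y := Num.truncn ((4 * p - 3 - eps / 2) * n%:R).
  have /andP[y1 y2] : y%:R <= (4 * p - 3 - eps / 2) * n%:R < y.+1%:R.
    by apply: truncn_itv; apply: mulr_ge0; lra.
  apply: (@le_trans _ _ (expect (run_prob p pos) wnext n [::] (fun w => (pos w <=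
    y%:Z)%R%:R))).
    apply: expect_mono => [w|w]; first by apply: run_prob01; lra.
    rewrite ler_nat; case: (lerP _ ((4 * p - 3 - eps) * n%:R)) => // h.
    have -> : pos w <= y%:Z; last by [].
    rewrite -ltzD1 -(ltr_int R) intrD; move: y2; rewrite -[y.+1%:R]natr1.
    have : 0 <= eps * n%:R by lra.
    rewrite -[y%:Z%:~R]/(y%:R); lra.
  apply: (le_trans (walk_left_of y n p34 p1 k0)).
  apply: lerD; last by rewrite ler_pM2l // -/c2.
  apply: le_trans hCn.
  apply: expect_mono => [t|t]; first by apply: xprob01; lra.
  rewrite ler_nat; case: (ltnP _ (y + 3 * k)) => // h.
  suff -> : eps / 4 * n%:R <= `|(sites t)%:R - (4 * p - 3) * n%:R| by [].
  rewrite ler_normr; apply/orP; right.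
  have : (sites t)%:R <= (y + 3 * k)%:R :> R by rewrite ler_nat ltnW.
  rewrite natrD natrM; lra.
apply: (@le_trans _ _ (C / L%:R ^+ 2 + (C / L%:R ^+ 2 + 2 * (c2 * ((32 / eps) ^+ 2) /
  L%:R ^+ 2)))); last first.
  by rewrite le_eqVlt; apply/orP; left; apply/eqP; ring.
apply: le_trans (lerD up lo); rewrite -expect_add.
apply: expect_mono => [w|w]; first by apply: run_prob01; lra.
rewrite -natrD ler_nat ler_normr.
set a := (_ <= _ - _); set b := (_ <= - _).
have ha : a -> (4 * p - 3 + eps) * n%:R <= (pos w)%:~R by rewrite /a; lra.
have hb : b -> (pos w)%:~R <= (4 * p - 3 - eps) * n%:R by rewrite /b; lra.
by case: a ha hb => [/(_ isT) -> _|_] //; case: b => // /(_ isT) ->; rewrite addn1.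
Qed.


(** * Almost sure convergence *)

(** Bernoulli's inequality in reverse: [(1 + x) ^ M <= 1 + (2 ^ M - 1) * x] for
    [0 <= x <= 1]. *)
Lemma powerS_ratio (R : realFieldType) (M L : nat) (eps : R) :
  (0 < L)%N -> 2 ^+ M <= eps * L%:R ->
  L.+1%:R ^+ M <= (1 + eps) * L%:R ^+ M :> R.
Proof.
move=> L0 hL; have LR : 0 < L%:R :> R by rewrite ltr0n.
have L1 : 1 <= L%:R :> R by rewrite ler1n.
have H k : L%:R * L.+1%:R ^+ k <= (L%:R + (2 ^+ k - 1)) * L%:R ^+ k :> R.
  elim: k => [|k IH]; first by rewrite !expr0 subrr addr0.
  rewrite exprSr mulrA;
    apply: (@le_trans _ _ ((L%:R + (2 ^+ k - 1)) * L%:R ^+ k * L.+1%:R)).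
    by rewrite ler_wpM2r.
  have t1 : 1 <= 2 ^+ k :> R by rewrite exprn_ege1 // ler1n.
  have a0 : 0 <= L%:R ^+ k :> R by rewrite exprn_ge0.
  rewrite -[L.+1%:R]natr1 !exprS.
  move: (L%:R ^+ k : R) (2 ^+ k : R) (L%:R : R) a0 t1 L1 => u t l u0 t1 l1.
  have h : (l + (t - 1)) * (l + 1) <= (l + (2 * t - 1)) * l by nra.
  have := ler_wpM2l u0 h; lra.
have LM : 0 < L%:R ^+ M :> R by rewrite exprn_gt0.
rewrite -(ler_pM2l LR); apply: (le_trans (H M)).
rewrite mulrA ler_wpM2r ?(ltW LM) //; lra.
Qed.

Lemma nearest_neighbour_dist (x : nat -> int) (m k : nat) :
  (forall n, `|x n.+1 - x n| <= 1) -> `|x (m + k)%N - x m| <= k%:Z.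
Proof.
move=> h; elim: k => [|k IH]; first by rewrite addn0 subrr normr0.
by rewrite addnS; have := h (m + k)%N; lia.
Qed.

(** Consecutive times [L ^ M] have ratio close to one, and between two of them the
    walk moves by at most their difference. *)
Lemma interpolate (R : archiRealFieldType) (x : nat -> int) (v eps : R) (M L1 : nat) :
  (0 < M)%N -> 0 < eps -> `|v| <= 1 ->
  (forall n, `|x n.+1 - x n| <= 1) ->
  (forall L, (L1 <= L)%N ->
     ~~ (eps * (L ^ M)%:R <= `|(x (L ^ M)%N)%:~R - v * (L ^ M)%:R|)) ->
  exists n0, forall n, (n0 <= n)%N -> `|v - (x n)%:~R / n%:R| <= 3 * eps.
Proof.
move=> M0 e0 v1 nn hx.
pose L2 := (maxn L1 (Num.bound (2 ^+ M / eps))).+1.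
exists (L2 ^ M)%N => n hn.
have ex : exists L, (L ^ M <= n)%N by exists L2.
have bd L : (L ^ M <= n)%N -> (L <= n)%N.
  move=> h; apply: leq_trans h; case: L => [|L] //.
  by rewrite -[X in (X <= _)%N]expn1 leq_pexp2l.
case: (ex_maxnP ex bd) => L Ln Lmax.
have L2L : (L2 <= L)%N by apply: Lmax.
have L0 : (0 < L)%N by apply: leq_trans L2L.
have nL : (n < L.+1 ^ M)%N.
  by rewrite ltnNge; apply/negP => /Lmax; rewrite ltnn.
have L1L : (L1 <= L)%N by apply: leq_trans L2L; rewrite leqW // leq_maxl.
have hL := hx L L1L; rewrite -ltNge in hL.
have eL : 2 ^+ M <= eps * L%:R.
  rewrite mulrC -ler_pdivrMr //; apply: ltW.
  apply: (@lt_le_trans _ _ (Num.bound (2 ^+ M / eps))%:R).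
    by apply: archi_boundP; rewrite divr_ge0 ?exprn_ge0 // ltW.
  by rewrite ler_nat; apply: leq_trans L2L; rewrite leqW // leq_maxr.
have rat := powerS_ratio L0 eL.
have [m mE] : exists m, m = (L ^ M)%N by eexists.
rewrite -mE in hL Ln.
have nR : n%:R <= (1 + eps) * m%:R.
  apply: le_trans (_ : L.+1%:R ^+ M <= _); last by rewrite mE natrX.
  by rewrite -natrX ler_nat ltnW.
have m0 : (0 < m)%N by rewrite mE expn_gt0 L0.
have mR : 0 < m%:R :> R by rewrite ltr0n.
have n0 : 0 < n%:R :> R by rewrite ltr0n; apply: leq_trans Ln.
have mn : m%:R <= n%:R :> R by rewrite ler_nat.
have dist : `|(x n)%:~R - (x m)%:~R| <= n%:R - m%:R :> R.
  have := nearest_neighbour_dist m (n - m) nn; rewrite subnKC //.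
  by rewrite -(ler_int R) intr_norm intrD mulrNz -[(n - m)%N%:Z%:~R]/((n - m)%:R) natrB.
have -> : v - (x n)%:~R / n%:R = - ((x n)%:~R - v * n%:R) / n%:R.
  by field; rewrite gt_eqF.
rewrite mulNr normrN normrM normfV (gtr0_norm n0) ler_pdivrMr //.
have -> : (x n)%:~R - v * n%:R = ((x n)%:~R - (x m)%:~R) + ((x m)%:~R - v * m%:R)
   + (- v * (n%:R - m%:R)) by ring.
have vb : `|- v * (n%:R - m%:R)| <= n%:R - m%:R.
  rewrite normrM normrN (ger0_norm (_ : 0 <= n%:R - m%:R)) ?subr_ge0 //.
  by rewrite ler_piMl // subr_ge0.
apply: (le_trans (ler_normD _ _)).
apply: (le_trans (lerD (ler_normD _ _) (lexx _))).
have : eps * m%:R <= eps * n%:R by rewrite ler_pM2l.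
lra.
Qed.

Theorem theorem1p4 (R : realType) (d : measure_display) (T : measurableType d)
    (P : probability T R) (p : R) (X : nat -> T -> int)
    (p_ge : 3 / 4 <= p) (p_lt1 : p < 1) (HX : is_HYC_walk P p X) :
  has_speed P X (4 * p - 3).
Proof.
have p2 : 2^-1 <= p by lra.
have close k : {ae P, forall t, exists n0, forall n, (n0 <= n)%N ->
    `|(4 * p - 3) - (X n t)%:~R / n%:R| <= 3 * k.+1%:R^-1}.
  have e0 : 0 < k.+1%:R^-1 :> R by rewrite invr_gt0.
  have [M [C [L0 [M1 hC]]]] := walk_concentration p_ge p_lt1 e0.
  pose Q L i := k.+1%:R^-1 * (L ^ M)%:R <= `|i%:~R - (4 * p - 3) * (L ^ M)%:R|.
  have avoid : {ae P, forall t, exists L1, forall L, (L1 <= L)%N ->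
      ~~ Q L (X (L ^ M)%N t)}.
    apply: (@eventually_avoids R d T P p X HX C L0 (fun L => L ^ M)%N Q) => L hL.
    apply: le_trans (walk_event_le HX (L ^ M) (Q L) p2 (ltW p_lt1)) _.
    by rewrite lee_fin; apply: hC.
  have := ae_nearest_neighbour HX; move: avoid.
  apply: filterS2 => t [L1 hL1] nn.
  by apply: (interpolate (ltnW M1) e0 _ nn hL1); rewrite ler_norml; lra.
have : {ae P, forall t, forall k, exists n0, forall n, (n0 <= n)%N ->
    `|(4 * p - 3) - (X n t)%:~R / n%:R| <= 3 * k.+1%:R^-1} by apply/ae_foralln.
apply: filterS => t h; apply/cvgrPdist_le => e e0.
have [n0 hn0] := h (Num.bound (3 / e)).
near=> n; apply: le_trans (hn0 n _) _; first by near: n; exists n0.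
have : 3 / e < (Num.bound (3 / e)).+1%:R.
  apply: (@lt_le_trans _ _ (Num.bound (3 / e))%:R); last by rewrite ler_nat.
  by apply: archi_boundP; rewrite divr_ge0 // ltW.
rewrite ltr_pdivrMr // => h3; rewrite ler_pdivrMr // mulrC; exact: ltW.
Unshelve. all: by end_near.
Qed.
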